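(* Let $n,m\in\mathbb{N}$, let $\omega:[0,1]^m\to[0,\infty)$ be an integrable function, and let $1<p<p_i<\infty$ and $-1/p_i\le\lambda_i<0$ for $i=1,\ldots,m$, with $1/p=1/p_1+\cdots+1/p_m$ and $\lambda=\lambda_1+\cdots+\lambda_m$. Put $$\widetilde{\mathbb{A}}_m:=\int_{0<t_1,\ldots,t_m<1}\left(\prod_{i=1}^m t_i^{n\lambda_i}\right)\omega(t_1,\ldots,t_m)\,dt_1\cdots dt_m.$$ (i) If $\widetilde{\mathbb{A}}_m<\infty$, then the weighted multilinear Hardy operator $\mathcal{H}_\omega^m$ is bounded from $\dot{B}^{p_1,\lambda_1}(\mathbb{R}^n)\times\cdots\times\dot{B}^{p_m,\lambda_m}(\mathbb{R}^n)$ to $\dot{B}^{p,\lambda}(\mathbb{R}^n)$, with operator norm not more than $\widetilde{\mathbb{A}}_m$. (ii) Assume that $\lambda_1p_1=\cdots=\lambda_mp_m$. In this case the condition $\widetilde{\mathbb{A}}_m<\infty$ is also necessary for the boundedness of $\mathcal{H}_\omega^m:\dot{B}^{p_1,\lambda_1}(\mathbb{R}^n)\times\cdots\times\dot{B}^{p_m,\lambda_m}(\mathbb{R}^n)\to\dot{B}^{p,\lambda}(\mathbb{R}^n)$. Moreover, $$\|\mathcal{H}_\omega^m\|_{\dot{B}^{p_1,\lambda_1}(\mathbb{R}^n)\times\cdots\times\dot{B}^{p_m,\lambda_m}(\mathbb{R}^n)\to\dot{B}^{p,\lambda}(\mathbb{R}^n)}=\widetilde{\mathbb{A}}_m.$$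
   Context: For complex-valued measurable functions $f_1,\ldots,f_m$ on $\mathbb{R}^n$ and $\vec f=(f_1,\ldots,f_m)$, the weighted multilinear Hardy operator is $$\mathcal{H}_{\omega}^m(\vec f)(x):=\int_{0<t_1,\ldots,t_m<1}\left(\prod_{i=1}^m f_i(t_ix)\right)\omega(t_1,\ldots,t_m)\,dt_1\cdots dt_m,\qquad x\in\mathbb{R}^n.$$ For $1<p<\infty$ and $\lambda\in\mathbb{R}$, the central Morrey space $\dot{B}^{p,\lambda}(\mathbb{R}^n)$ is the space of all locally $p$-integrable functions $f$ on $\mathbb{R}^n$ with $$\|f\|_{\dot{B}^{p,\lambda}}:=\sup_{R>0}\left(\frac{1}{|B(0,R)|^{1+\lambda p}}\int_{B(0,R)}|f(x)|^p\,dx\right)^{1/p}<\infty,$$ where $B(0,R)$ is the ball of radius $R$ centered at $0$ and $|B(0,R)|$ its Lebesgue measure. A multilinear operator $T$ is bounded from $X_1\times\cdots\times X_m$ to $Y$ if there is a finite $C$ with $\|T(\vec f)\|_Y\le C\prod_{i=1}^m\|f_i\|_{X_i}$ for all $f_i\in X_i$; its operator norm is the least such $C$. *)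

(* Defs.v *)
From HB Require Import structures.
From mathcomp Require Import all_boot all_order all_algebra.
From mathcomp Require Import all_classical all_reals all_analysis.
From mathcomp Require Import complex.

Set Implicit Arguments.
Unset Strict Implicit.
Unset Printing Implicit Defensive.

Import Order.TTheory GRing.Theory Num.Theory.
Import numFieldNormedType.Exports.

Local Open Scope classical_set_scope.
Local Open Scope ring_scope.

Section cons_measure.
Local Open Scope ereal_scope.
Context {R : realType} (n : nat).
Local Notation T := (measurableTypeR R).
Variable mu : {sigma_finite_measure set (n.-tuple T) -> \bar R}.

Definition cons_pair (x : T * n.-tuple T) : n.+1.-tuple T :=
  [tuple of x.1 :: x.2].

Lemma measurable_cons_pair : measurable_fun [set: _] cons_pair.
Proof. exact: (measurable_cons measurable_fst measurable_snd). Qed.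

Definition cons_measure : set (n.+1.-tuple T) -> \bar R :=
  pushforward (lebesgue_measure \x mu) cons_pair.

Let mcons A : measurable A -> measurable (cons_pair @^-1` A).
Proof.
by move=> mA; rewrite -[X in measurable X]setTI; exact: measurable_cons_pair.
Qed.

Let cons_measure0 : cons_measure set0 = 0.
Proof. by rewrite /cons_measure /pushforward preimage_set0 measure0. Qed.

Let cons_measure_ge0 A : 0 <= cons_measure A.
Proof. exact: (measure_ge0 (lebesgue_measure \x mu)). Qed.

Let cons_measure_sigma_additive : semi_sigma_additive cons_measure.
Proof.
move=> F mF tF mUF; rewrite /cons_measure /pushforward preimage_bigcup.
apply: (measure_semi_sigma_additive (s := (lebesgue_measure \x mu))).
- by move=> k; exact: mcons.
- apply/trivIsetP => i j _ _ ij; rewrite -preimage_setI.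
  by move/trivIsetP : tF => /(_ _ _ _ _ ij) ->//; rewrite preimage_set0.
- by rewrite -preimage_bigcup; exact: mcons.
Qed.

HB.instance Definition _ := isMeasure.Build _ _ _ cons_measure
  cons_measure0 cons_measure_ge0 cons_measure_sigma_additive.

Let uncons (x : n.+1.-tuple T) : T * n.-tuple T :=
  (tnth x ord0, [tuple of behead x]).

Let measurable_uncons : measurable_fun [set: _] uncons.
Proof.
apply/measurable_fun_pairP; split; first exact: measurable_tnth.
exact: measurable_behead.
Qed.

Let cons_measure_sigma_finite : sigma_finite [set: _] cons_measure.
Proof.
have /sigma_finiteP[F [FT ndF Foo]] := sigma_finiteT (@lebesgue_measure R).
have /sigma_finiteP[G [GT ndG Goo]] := sigma_finiteT mu.
exists (fun k => uncons @^-1` (F k `*` G k)).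
  apply/esym; rewrite -subTset => x _.
  have [k _ Fk] : (\bigcup_i F i) (uncons x).1 by rewrite -FT.
  have [l _ Gl] : (\bigcup_i G i) (uncons x).2 by rewrite -GT.
  exists (maxn k l) => //; split.
  - by move: Fk; exact/subsetPset/ndF/leq_maxl.
  - by move: Gl; exact/subsetPset/ndG/leq_maxr.
move=> k; have [mF Fk] := Foo k; have [mG Gk] := Goo k; split.
  rewrite -[X in measurable X]setTI.
  by apply: measurable_uncons => //; exact: measurableX.
rewrite /cons_measure /pushforward -comp_preimage.
rewrite (_ : uncons \o cons_pair = id); last first.
  by apply/funext => -[x y]; congr pair; exact/val_inj.
by rewrite preimage_id product_measure1E// lte_mul_pinfty// ge0_fin_numE.
Qed.

HB.instance Definition _ := Measure_isSigmaFinite.Build _ _ _ cons_measure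
  cons_measure_sigma_finite.

End cons_measure.

(* n-fold product of the one-dimensional Lebesgue measure, on Borel sets *)
Fixpoint product_lebesgue (R : realType) (n : nat) :
    {sigma_finite_measure set (n.-tuple (measurableTypeR R)) -> \bar R} :=
  match n with
  | 0 => dirac [tuple]
  | n'.+1 => cons_measure (product_lebesgue R n')
  end.

(* R^n, with the sigma-algebra of Lebesgue measurable sets *)
Definition Rn (R : realType) (n : nat) : Type :=
  caratheodory_type (product_lebesgue R n)^*%mu.

HB.instance Definition _ (R : realType) (n : nat) := Measurable.copy (Rn R n)
  (caratheodory_type (product_lebesgue R n)^*%mu).

Definition lebesgue_Rn (R : realType) (n : nat) : set (Rn R n) -> \bar R :=
  @completed_measure_extension _ _ _ (product_lebesgue R n).
HB.instance Definition _ (R : realType) (n : nat) :=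
  Measure.on (@lebesgue_Rn R n).

Lemma lebesgue_Rn_sigma_finite (R : realType) (n : nat) :
  sigma_finite [set: Rn R n] (@lebesgue_Rn R n).
Proof. exact/completed_measure_extension_sigma_finite/sigma_finiteT. Qed.

HB.instance Definition _ (R : realType) (n : nat) :=
  @isSigmaFinite.Build _ _ _ (@lebesgue_Rn R n)
    (@lebesgue_Rn_sigma_finite R n).

Arguments lebesgue_Rn : clear implicits.

Lemma product_lebesgue_rectangle (R : realType) (n : nat)
    (A : 'I_n -> set (measurableTypeR R)) :
  (forall i, measurable (A i)) ->
  product_lebesgue R n [set x | forall i, A i (tnth x i)] =
  (\prod_(i < n) lebesgue_measure (A i))%E.
Proof.
elim: n A => [|n IH] A mA /=.
  by rewrite big_ord0 diracE mem_set// => -[].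
rewrite big_ord_recl -IH//.
rewrite /cons_measure /pushforward [X in product_measure1 _ _ X](_ : _ =
  A ord0 `*` [set x | forall i, A (lift ord0 i) (tnth x i)]).
  rewrite product_measure1E//.
  rewrite (_ : mkset _ = \bigcap_(i in [set: 'I_n])
      (fun x : n.-tuple (measurableTypeR R) => tnth x i) @^-1`
        A (lift ord0 i)).
    apply: fin_bigcap_measurable; first exact: finite_finset.
    move=> i _; rewrite -[X in measurable X]setTI.
    exact: (measurable_tnth i).
  by apply/seteqP; split => [x Ax i _|x Ax i]; [exact: Ax | exact: (Ax i I)].
apply/seteqP; split => -[x y] /=.
  move=> Axy; split; first exact: (Axy ord0).
  by move=> i; have := Axy (lift ord0 i); rewrite tnthS.
move=> [Ax Ay] i; case: (unliftP ord0 i) => [j ->|-> //].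
by rewrite tnthS.
Qed.

Lemma lebesgue_Rn_rectangle (R : realType) (n : nat)
    (A : 'I_n -> set (measurableTypeR R)) :
  (forall i, measurable (A i)) ->
  lebesgue_Rn R n [set x | forall i, A i (tnth x i)] =
  (\prod_(i < n) lebesgue_measure (A i))%E.
Proof.
move=> mA; rewrite -product_lebesgue_rectangle//.
apply: measurable_mu_extE.
rewrite (_ : mkset _ = \bigcap_(i in [set: 'I_n])
    (fun x : n.-tuple (measurableTypeR R) => tnth x i) @^-1` A i).
  apply: fin_bigcap_measurable; first exact: finite_finset.
  by move=> i _; rewrite -[X in measurable X]setTI; exact: (measurable_tnth i).
by apply/seteqP; split => [x Ax i _|x Ax i]; [exact: Ax | exact: (Ax i I)].
Qed.

Section euclidean.
Context {R : realType} {n : nat}.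
Implicit Types (x y : Rn R n) (t r : R).

Definition coord x (i : 'I_n) : R := tnth x i.

Definition dilate t x : Rn R n := [tuple t * coord x i | i < n].

Definition eball x r : set (Rn R n) :=
  [set y | Num.sqrt (\sum_(i < n) (coord y i - coord x i) ^+ 2) < r].

Definition origin : Rn R n := [tuple 0 | i < n].

Definition open_cube : set (Rn R n) := [set x | forall i, 0 < coord x i < 1].

Definition closed_cube : set (Rn R n) :=
  [set x | forall i, 0 <= coord x i <= 1].

End euclidean.

Section complex_functions.
Context d (T : measurableType d) (R : realType).
Implicit Types (mu : {measure set T -> \bar R}) (D : set T) (f : T -> R[i]).

Definition cmeasurable D f : Prop :=
  measurable_fun D (fun x => complex.Re (f x)) /\
  measurable_fun D (fun x => complex.Im (f x)).

Definition cintegrable mu D f : Prop :=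
  mu.-integrable D (fun x => (complex.Re (f x))%:E) /\
  mu.-integrable D (fun x => (complex.Im (f x))%:E).

Definition cintegral mu D f : R[i] :=
  Complex (\int[mu]_(x in D) complex.Re (f x))
          (\int[mu]_(x in D) complex.Im (f x)).

End complex_functions.

Section central_morrey.
Context {R : realType} {n : nat}.
Implicit Types (p lambda : R) (f : Rn R n -> R[i]).

Definition pth_integral p f (B : set (Rn R n)) : \bar R :=
  (\int[lebesgue_Rn R n]_(x in B) (Normc.normc (f x) `^ p)%:E)%E.

Definition morrey_norm p lambda f : \bar R :=
  ereal_sup [set
    (((lebesgue_Rn R n (eball origin r) `^ (1 + lambda * p))^-1 *
      pth_integral p f (eball origin r)) `^ p^-1)%E
    | r in [set r : R | 0 < r]].

Definition locally_p_integrable p f : Prop :=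
  cmeasurable [set: Rn R n] f /\
  forall x, exists2 r : R, 0 < r & (pth_integral p f (eball x r) < +oo)%E.

Definition in_morrey p lambda f : Prop :=
  locally_p_integrable p f /\ (morrey_norm p lambda f < +oo)%E.

End central_morrey.

Section hardy_operator.
Context {R : realType} (n : nat) {m : nat} (omega : Rn R m -> R).
Implicit Types (f : 'I_m -> Rn R n -> R[i]) (x : Rn R n) (t : Rn R m).

Definition hardy_integrand f x t : R[i] :=
  (\prod_(i < m) f i (dilate (coord t i) x)) * (omega t)%:C%C.

Definition hardy f x : R[i] :=
  cintegral (lebesgue_Rn R m) open_cube (hardy_integrand f x).

Definition hardy_defined f x : Prop :=
  cintegrable (lebesgue_Rn R m) open_cube (hardy_integrand f x).

Definition hardy_constant (lambdas : 'I_m -> R) : \bar R :=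
  (\int[lebesgue_Rn R m]_(t in open_cube)
    ((\prod_(i < m) coord t i `^ (n%:R * lambdas i)) * omega t)%:E)%E.

(* The library integral of a non-integrable function is a junk value, so that
   the integral defining the operator is required to exist almost everywhere. *)
Definition hardy_bound (ps lambdas : 'I_m -> R) (p lambda C : R) : Prop :=
  0 <= C /\
  forall f, (forall i, in_morrey (ps i) (lambdas i) (f i)) ->
    [/\ {ae lebesgue_Rn R n, forall x, hardy_defined f x},
        in_morrey p lambda (hardy f) &
        (morrey_norm p lambda (hardy f) <=
         C%:E * \prod_(i < m) morrey_norm (ps i) (lambdas i) (f i))%E].

Definition hardy_bounded ps lambdas p lambda : Prop :=
  exists C, hardy_bound ps lambdas p lambda C.

(* +oo when the operator is not bounded *)
Definition hardy_opnorm ps lambdas p lambda : \bar R :=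
  ereal_inf [set C%:E | C in hardy_bound ps lambdas p lambda].

End hardy_operator.

(* Main.v *)
Require Import Defs.
From HB Require Import structures.
From mathcomp Require Import all_boot all_order all_algebra.
From mathcomp Require Import all_classical all_reals all_analysis.
From mathcomp Require Import measurable_realfun complex ring lra.
Import Defs.

(** Functions measurable for the completed sigma-algebra are first replaced by
    Borel functions; as dilations preserve null sets, by Fubini this changes the
    operator on a null set only.

    Upper bound.  Up to the product of the norms of the [f_i] and
    [|B(0,r)|^(lambda + 1/p)], the modulus of the integrand at [(x, t)] is
    [U(x, t) k(t)], where [k(t) = prod_i t_i^(n lambda_i) omega(t)] has integral
    [A] and, by weighted AM-GM and the dilation [x |-> t_i x] in each factor, the
    integral of [U(., t)^p] over [B(0,r)] is at most 1 for every [t]; Hoelder's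
    inequality then bounds the integral of [(int U k)^p] by [A^p].

    Lower bound.  Let [theta = - lambda_i p_i], which does not depend on [i].  A
    test with [f_i = |x|^(n lambda_i)] itself fails: when [theta = 1] it does not
    belong to the space.  Truncate it to the shell [1 <= |x| < b] and let [K] be a
    bound of the Morrey averages of [|x|^(-n theta)] on that shell.  If [A_N] is
    the part of [A] carried by [t_i >= 1/N], the operator is at least
    [A_N |x|^(n lambda)] on [N <= |x| < b], so that an operator bound [C] yields
    after rescaling the bound [(C / A_N)^p K] on the shell [1 <= |x| < b/N].  For
    [b = N^(k+1)] one can take [K = (k+1) K_1]; descending [k] times to the shell
    [1 <= |x| < N] forces [A_N <= C], and [N] tends to infinity. *)

Set Implicit Arguments.
Unset Strict Implicit.
Unset Printing Implicit Defensive.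

Import Order.TTheory GRing.Theory Num.Theory.
Import numFieldNormedType.Exports.

Local Open Scope ring_scope.

(** * Measurable hulls and modifications for a completed measure *)

Section completion.
Context d (T : measurableType d) (R : realType).
Variable mu : {sigma_finite_measure set T -> \bar R}.
Local Open Scope classical_set_scope.
Local Open Scope ereal_scope.
Local Notation cT := (caratheodory_type mu^*%mu).
Local Notation nu := (@completed_measure_extension _ _ _ mu).

Lemma measurable_caratheodory (A : set T) :
  measurable A -> measurable (A : set cT).
Proof. by move=> mA; apply: sub_caratheodory; exact: sub_gen_smallest. Qed.

(** Intersect covers of [A] whose total measure exceeds the outer measure by at most 1/(k+1). *)
Lemma mu_ext_hull (A : set T) :
  exists B, [/\ measurable B, A `<=` B & mu B <= mu^*%mu A].
Proof.
have [Aoo|Afin] := eqVneq (mu^*%mu A) +oo.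
  by exists setT; split => //; rewrite Aoo leey.
have fA : mu^*%mu A \is a fin_num by rewrite ge0_fin_numE ?ltey// mu_ext_ge0.
have cov k : exists F : (set T)^nat, measurable_cover A F /\
    \sum_(0 <= i <oo) mu (F i) <= mu^*%mu A + (k.+1%:R^-1)%:E.
  have := @lb_ereal_inf_adherent _ [set \sum_(0 <= k <oo) mu (F k) | F in measurable_cover A]
    (k.+1%:R^-1)%R ltac:(by rewrite invr_gt0) fA.
  by case=> _ [F cF <-] /ltW FA; exists F.
have {cov}[F FP] := choice cov.
have mF k : measurable (\bigcup_i F k i).
  by apply: bigcup_measurable => i _; have [[mF _] _] := FP k.
exists (\bigcap_k \bigcup_i F k i); split.
- exact: bigcap_measurable.
- by move=> x Ax k _; have [[_ AF] _] := FP k; exact: AF.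
apply/lee_addgt0Pr => e e0.
have [k ke] : exists k, (k.+1%:R^-1 < e)%R.
  have [k _ /(_ k (leqnn k)) ke] := near_infty_natSinv_lt (PosNum e0).
  by exists k.
have [[mFk _] Fk] := FP k.
apply: (@le_trans _ _ (mu^*%mu A + (k.+1%:R^-1)%:E)); last first.
  by rewrite leeD2l// lee_fin ltW.
apply: le_trans Fk.
apply: (@le_trans _ _ (mu (\bigcup_i F k i))).
  apply: le_measure; rewrite ?inE//; first exact: bigcap_measurable.
  by move=> x; exact.
by apply: measure_sigma_subadditive.
Qed.

Lemma caratheodory_null (N : set T) :
  mu^*%mu N = 0 -> exists M, [/\ measurable M, N `<=` M & mu M = 0].
Proof.
move=> N0; have [M [mM NM MN]] := mu_ext_hull N.
by exists M; split => //; apply/eqP; rewrite -measure_le0 -N0.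
Qed.

Lemma caratheodory_measurable_null (N A : set T) :
  measurable N -> mu N = 0 -> A `<=` N -> measurable (A : set cT).
Proof.
move=> mN N0 AN; apply: le_caratheodory_measurable => X.
have XA0 : mu^*%mu (X `&` A) = 0.
  apply/eqP; rewrite eq_le; apply/andP; split; last exact: mu_ext_ge0.
  rewrite -N0 -(measurable_mu_extE mu mN).
  by apply: (le_mu_ext mu) => x [_ /AN].
rewrite [Y in Y + _ <= _](_ : _ = 0)// add0e.
by apply: (le_mu_ext mu) => x [].
Qed.

(** On each piece of finite measure the hull exceeds [A] by a null set, which a measurable null set
    covers. Off the union of these null sets, [A] agrees with the union of the hulls. *)
Lemma caratheodory_measurable_mod_null (A : set cT) : measurable A ->
  exists N : set T, [/\ measurable N, mu N = 0 & measurable (A `\` N : set T)].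
Proof.
move=> mA; have [S ST Sfin] := sigma_finiteT mu.
pose Ak k : set cT := A `&` (S k : set cT).
have mAk k : measurable (Ak k).
  by apply: measurableI => //; apply: measurable_caratheodory; have [] := Sfin k.
have hull k : exists BN : set T * set T,
    [/\ measurable BN.1, Ak k `<=` BN.1,
     measurable BN.2, BN.1 `\` Ak k `<=` BN.2 & mu BN.2 = 0].
  have [B [mB AB BA]] := mu_ext_hull (Ak k : set T).
  have mBc := measurable_caratheodory mB.
  have Bfin : nu (B : set cT) < +oo.
    rewrite [X in X < _](measurable_mu_extE mu mB).
    apply: (le_lt_trans BA).
    apply: (@le_lt_trans _ _ (mu^*%mu (S k))).
      by apply: le_mu_ext => x [].
    by have [mS] := Sfin k; rewrite measurable_mu_extE.
  have : nu (B `\` Ak k : set cT) = 0.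
    have Afin : nu (Ak k) \is a fin_num.
      rewrite ge0_fin_numE//; apply: le_lt_trans Bfin.
      by apply: le_measure => //; rewrite inE.
    have BAk : nu (B : set cT) = nu (Ak k).
      apply/eqP; rewrite eq_le; apply/andP; split.
        by rewrite [X in X <= _](measurable_mu_extE mu mB).
      by apply: le_measure => //; rewrite inE.
    have -> : nu (B `\` Ak k : set cT) = nu (B : set cT) - nu (Ak k).
      by rewrite [LHS](measureD (mu := nu))// setIidr.
    by rewrite BAk subee.
  by move=> /caratheodory_null[N [mN BN N0]]; exists (B, N).
have {hull}[BN BNP] := choice hull.
exists (\bigcup_k (BN k).2); split.
- by apply: bigcup_measurable => k _; have [] := BNP k.
- apply/eqP; rewrite -measure_le0.
  apply: (@le_trans _ _ (\sum_(0 <= k <oo) mu (BN k).2)).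
    apply: measure_sigma_subadditive => //.
    + by move=> k; have [] := BNP k.
    + by apply: bigcup_measurable => k _; have [] := BNP k.
  by rewrite eseries0// => k _ _; have [] := BNP k.
- rewrite (_ : A `\` _ = (\bigcup_k (BN k).1) `\` (\bigcup_k (BN k).2)).
    by apply: measurableD; apply: bigcup_measurable => k _; have [] := BNP k.
  apply/seteqP; split => [x [Ax Nx]|x [[k _ Bx] Nx]]; split => //.
    have [k _ Sx] : (\bigcup_k S k) x by rewrite -ST.
    by exists k => //; have [_ + _ _ _] := BNP k; apply.
  apply: contrapT => nAx; apply: Nx; exists k => //.
  by have [_ _ _ + _] := BNP k; apply; split => // -[].
Qed.

(* Redefining a completed-measurable function as 0 on a null set makes it
   measurable for the smaller sigma-algebra. *)
Lemma caratheodory_measurable_fun_mod_null (f : cT -> R) :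
  measurable_fun [set: cT] f ->
  exists N : set T, [/\ measurable N, mu N = 0 &
    measurable_fun [set: T] (fun x : T => if x \in N then 0%R else f x)].
Proof.
move=> mf; pose q k : rat := odflt 0%R (unpickle k).
have mfq k : exists N : set T, [/\ measurable N, mu N = 0 &
    measurable (f @^-1` `]-oo, (ratr (q k) : R)[ `\` N : set T)].
  apply: caratheodory_measurable_mod_null.
  by rewrite -[X in measurable X]setTI; exact: mf.
have {mfq}[M MP] := choice mfq.
have mM : measurable (\bigcup_k M k).
  by apply: bigcup_measurable => k _; have [] := MP k.
exists (\bigcup_k M k); split => //.
- apply/eqP; rewrite -measure_le0.
  apply: (@le_trans _ _ (\sum_(0 <= k <oo) mu (M k))).
    by apply: measure_sigma_subadditive => // k; have [] := MP k.
  by rewrite eseries0// => k _ _; have [] := MP k.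
- apply: (measurability _ (RGenInftyO.measurableE R)) => _ [_ [r ->] <-].
  (* Off the exceptional set, a rational separates a value below r from r. On the exceptional set
     the new function is 0, so that set is added exactly when 0 < r. *)
  rewrite setTI (_ : _ @^-1` _ = (\bigcup_(k in [set k | (ratr (q k) < r)%R])
      ((f @^-1` `]-oo, (ratr (q k) : R)[ `\` M k) `\` \bigcup_k M k))
      `|` (if (0 < r)%R then \bigcup_k M k else set0)).
    apply: measurableU; last by case: ifP.
    apply: bigcup_measurable => k _; apply: measurableD => //.
    by have [] := MP k.
  apply/seteqP; split => x /=; rewrite !in_itv/=.
    case: ifPn => [/set_mem Mx r0|/negP Mx fr]; first by right; rewrite r0.
    left; have [s] := rat_in_itvoo fr; rewrite in_itv/= => /andP[fs sr].
    have qs : q (pickle s) = s by rewrite /q pickleK.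
    exists (pickle s) => /=; rewrite qs//; split; last by move=> /mem_set.
    split; first by rewrite in_itv.
    by move=> Msx; apply: Mx; apply/mem_set; exists (pickle s).
  case=> [[k qkr [[]]]|].
    by move=> fq _ Mx; rewrite memNset//; exact: lt_trans qkr.
  by case: ifPn => // r0 Mx; rewrite mem_set.
Qed.

End completion.

(** * Change of variables for a map that scales measure by a constant *)

Section integral_preimage.
Context d1 d2 (X : measurableType d1) (Y : measurableType d2) (R : realType).
Variables (phi : X -> Y) (mphi : measurable_fun [set: X] phi).
Variables (mu : {measure set X -> \bar R}) (nu : {measure set Y -> \bar R}).
Variables (c : {nonneg R}).
Hypothesis mu_preimage : forall A : set Y, measurable A ->
  mu (phi @^-1` A)%classic = (c%:num%:E * nu A)%E.

Let mphi_mixin := isMeasurableFun.Build _ _ _ _ _ mphi.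
Let mphi_pack : {mfun _ >-> _} := HB.pack phi mphi_mixin.

(** The hypothesis identifies the pushforward of [mu] with [c] times [nu]. This serves both for
    dilations and for the passage from the completed measure to the Borel one. *)
Lemma ge0_integral_preimage (D : set Y) (f : Y -> \bar R) :
  measurable D -> measurable_fun D f -> (forall y, D y -> (0 <= f y)%E) ->
  (\int[mu]_(x in (phi @^-1` D)%classic) f (phi x) =
   c%:num%:E * \int[nu]_(y in D) f y)%E.
Proof.
move=> mD mf f0; rewrite -ge0_integral_mscale//.
rewrite -(ge0_integral_pushforward mphi)//; last first.
  by move=> y /set_mem; exact: f0.
rewrite -[pushforward mu phi]/(pushforward mu mphi_pack).
by apply: eq_measure_integral => A mA _; exact: mu_preimage.
Qed.

End integral_preimage.

(** * Dilations and the Borel product measure *)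

Section dilation.
Context {R : realType}.
Local Open Scope classical_set_scope.
Local Open Scope ereal_scope.
Local Notation T := (measurableTypeR R).
Local Notation leb := (@lebesgue_measure R).

(** By uniqueness of Lebesgue measure: [t] times its pushforward gives half-open intervals their
    length. *)
Lemma lebesgue_measure_dilate (t : R) (A : set T) : (0 < t)%R ->
  measurable A -> leb ((fun x => t * x)%R @^-1` A) = (t^-1)%:E * leb A.
Proof.
move=> t0; have t0' : (0 <= t)%R by exact: ltW.
have mphi : measurable_fun [set: T] ((fun x => t * x)%R : T -> T).
  exact: measurable_funM.
move=> mA.
have [m mE] : exists m : {measure set T -> \bar R},
    forall B, m B = t%:E * leb ((fun x => t * x)%R @^-1` B).
  have [m1 m1E] : exists m1 : {measure set T -> \bar R},
      m1 = pushforward leb ((fun x => t * x)%R : T -> T) :> (set T -> \bar R).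
    by unshelve (eexists; reflexivity).
  by exists (mscale (NngNum t0') m1) => B; exact: (congr1 (fun m' => t%:E * m' B) m1E).
suff -> : leb A = m A by rewrite mE muleA -EFinM mulVf ?gt_eqF// mul1e.
apply: lebesgue_measure_unique => //= _ [[a b]] _ <-.
rewrite mE.
rewrite (_ : _ @^-1` _ = `](a / t)%R, (b / t)%R]); last first.
  by apply/seteqP; split => x /=; rewrite !in_itv/= ltr_pdivrMr// ler_pdivlMr// ![(x * t)%R]mulrC.
rewrite !lebesgue_measure_itv/= !lte_fin ltr_pM2r ?invr_gt0//.
case: ifPn => _; last by rewrite mule0.
by rewrite -!EFinB -EFinM -mulrBl mulrCA divff ?mulr1// gt_eqF.
Qed.

(* [dilate], typed as a map of the Borel space underlying [Rn R n] *)
Definition tdilate n (t : R) (x : n.-tuple T) : n.-tuple T := dilate t x.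

Lemma measurable_dilate n : measurable_fun
  [set: T * n.-tuple T] (fun tx => tdilate tx.1 tx.2).
Proof.
apply/measurable_fun_tnthP => i.
rewrite (_ : _ \o _ = (fun tx : T * n.-tuple T => tx.1 * tnth tx.2 i)%R).
  apply: measurable_funM; first exact: measurable_fst.
  by apply: (measurableT_comp (measurable_tnth i)); exact: measurable_snd.
by apply/funext => x /=; rewrite tnth_mktuple.
Qed.

Lemma measurable_dilatel n t :
  measurable_fun [set: n.-tuple T] (tdilate t).
Proof.
exact: (measurableT_comp (@measurable_dilate n) (measurable_pair1 t)).
Qed.

Lemma dilate_cons n (t a : R) (x : n.-tuple T) :
  tdilate t (cons_pair (a, x)) =
  cons_pair (t * a, tdilate t x)%R.
Proof.
apply: eq_from_tnth => i; rewrite tnth_mktuple.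
by case: (unliftP ord0 i) => [j ->|->]; rewrite /coord /= ?tnthS ?tnth0 ?tnth_mktuple.
Qed.

(** Induction on the dimension by slicing: the slices contribute t^-n by the induction hypothesis,
    the first coordinate one more factor 1/t. *)
Lemma product_lebesgue_dilate n (t : R) (A : set (n.-tuple T)) : (0 < t)%R ->
  measurable A ->
  product_lebesgue R n (tdilate t @^-1` A) =
  (t ^- n)%:E * product_lebesgue R n A.
Proof.
move=> t0; elim: n A => [|n IH] A mA.
  rewrite expr0 invr1 mul1e; congr (product_lebesgue _ _ _).
  by apply/seteqP; split => x /=; rewrite (tuple0 x) (tuple0 (tdilate _ _)).
pose mu := product_lebesgue R n.
have mA' : measurable (@cons_pair R n @^-1` A).
  by rewrite -[X in measurable X]setTI; exact: measurable_cons_pair.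
pose h (x : T) := (mu \o xsection (@cons_pair R n @^-1` A)) x.
have mh : measurable_fun [set: T] h by exact: measurable_fun_xsection.
(* [h] measures the slices of [A]; the slice at x of the dilated preimage is the dilated preimage of
   the slice at t x. *)
transitivity (\int[leb]_x ((t ^- n)%:E * h (t * x)%R)).
  apply: eq_integral => x _; rewrite -IH; last exact: measurable_xsection.
  congr (product_lebesgue _ _ _); apply/seteqP; split => y.
    by rewrite /xsection/= !inE/= dilate_cons.
  by rewrite /xsection/= !inE/= dilate_cons.
rewrite ge0_integralZl//; last 2 first.
- by apply: (measurableT_comp mh); exact: measurable_funM.
- by rewrite lee_fin invr_ge0 exprn_ge0// ltW.
have ti : (0 <= t^-1)%R by rewrite invr_ge0 ltW.
have := @ge0_integral_preimage _ _ _ _ _ ((fun x => t * x)%R : T -> T) _ leb leb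
  (NngNum ti) _ setT h.
rewrite preimage_setT => -> //.
- by rewrite muleA -EFinM -invfM -exprSr.
- exact: measurable_funM.
- by move=> B mB; exact: lebesgue_measure_dilate.
Qed.

Lemma ge0_integral_dilate n (t : R) (D : set (n.-tuple T)) (h : n.-tuple T -> \bar R) :
  (0 < t)%R -> measurable D -> measurable_fun D h ->
  (forall x, D x -> 0 <= h x) ->
  \int[product_lebesgue R n]_(x in tdilate t @^-1` D) h (tdilate t x) =
  (t ^- n)%:E * \int[product_lebesgue R n]_(x in D) h x.
Proof.
move=> t0 mD mh h0.
have tn : (0 <= t ^- n)%R by rewrite invr_ge0 exprn_ge0// ltW.
exact: (@ge0_integral_preimage _ _ _ _ _ (tdilate t)
  (measurable_dilatel t) (product_lebesgue R n) (product_lebesgue R n) (NngNum tn)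
  (fun A mA => product_lebesgue_dilate t0 mA) D h mD mh h0).
Qed.

Lemma ge0_integral_lebesgue_Rn n (D : set (n.-tuple T)) (h : n.-tuple T -> \bar R) :
  measurable D -> measurable_fun D h -> (forall x, D x -> 0 <= h x) ->
  \int[lebesgue_Rn R n]_(x in D) h x = \int[product_lebesgue R n]_(x in D) h x.
Proof.
move=> mD mh h0; rewrite -[RHS]mul1e.
have mid : measurable_fun [set: Rn R n] (id : Rn R n -> n.-tuple T).
  by move=> _ A mA; rewrite setTI; exact: measurable_caratheodory.
have muE (A : set (n.-tuple T)) : measurable A ->
    lebesgue_Rn R n (id @^-1` A) = 1%:nng%:num%:E * product_lebesgue R n A.
  by move=> mA; rewrite mul1e; exact: measurable_mu_extE.
exact: (@ge0_integral_preimage _ _ _ _ _ _ mid _ _ _ muE D h mD mh h0).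
Qed.

End dilation.

(** * Borel sets and null sets in the completed space *)

Section completeness.
Context {R : realType} {n : nat}.
Local Open Scope classical_set_scope.
Local Open Scope ereal_scope.
Local Notation Tn := (n.-tuple (measurableTypeR R)).
Local Notation mu := (product_lebesgue R n).
Local Notation leb := (lebesgue_Rn R n).

Lemma measurable_Rn (A : set Tn) : measurable A -> measurable (A : set (Rn R n)).
Proof. exact: measurable_caratheodory. Qed.

Lemma lebesgue_RnE (A : set Tn) : measurable A -> leb A = mu A.
Proof. exact: measurable_mu_extE. Qed.

Lemma measurable_funT_Rn d (U : measurableType d) (f : Tn -> U) :
  measurable_fun setT f -> measurable_fun [set: Rn R n] (f : Rn R n -> U).
Proof. by move=> mf _ A mA; apply: measurable_Rn; exact: mf. Qed.

Lemma negligible_measurable_Rn (N A : set Tn) :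
  measurable N -> mu N = 0 -> A `<=` N -> measurable (A : set (Rn R n)).
Proof.
move=> mN N0 AN; exact: caratheodory_measurable_null mN N0 AN.
Qed.

(** Off [N] the preimages are those of [g]; inside [N] every set is measurable by completeness. *)
Lemma measurable_fun_Rn_mod_null d (U : measurableType d) (N : set Tn) (f g : Tn -> U) :
  measurable N -> mu N = 0 -> measurable_fun setT g -> (forall x, ~ N x -> f x = g x) ->
  measurable_fun [set: Rn R n] (f : Rn R n -> U).
Proof.
move=> mN N0 mg fg _ A mA; rewrite setTI.
rewrite (_ : _ @^-1` _ = ((g @^-1` A) `\` N) `|` ((f @^-1` A) `&` N)); last first.
  apply/seteqP; split => x /=.
    by move=> fA; have [Nx|Nx] := pselect (N x); [right|left; rewrite -fg].
  by case=> -[//] gA Nx; rewrite fg.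
apply: measurableU; last first.
  by apply: (negligible_measurable_Rn mN) => // x [].
apply: measurable_Rn; apply: measurableD => //.
by rewrite -[X in measurable X]setTI; exact: mg.
Qed.

Lemma negligible_Rn (N : set Tn) : measurable N -> mu N = 0 ->
  leb.-negligible (N : set (Rn R n)).
Proof.
move=> mN N0; exists N; split => //; first exact: measurable_Rn.
by rewrite lebesgue_RnE.
Qed.

End completeness.

(** * Euclidean norm and volume of balls *)

Section balls.
Context {R : realType} {n : nat}.
Local Open Scope classical_set_scope.
Local Notation T := (measurableTypeR R).
Local Notation mu := (product_lebesgue R n).
Implicit Types (x : n.-tuple T) (t r : R).

Definition enorm x : R := Num.sqrt (\sum_(i < n) tnth x i ^+ 2).

(** The centered ball typed in the Borel space; [eball_origin] identifies it with
    [eball origin r]. *)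
Definition tball r : set (n.-tuple T) := [set x | enorm x < r].

Lemma eball_origin r : eball origin r = tball r.
Proof.
rewrite /eball /tball /enorm; congr mkset; apply/funext => x.
by under eq_bigr do rewrite /coord /origin tnth_mktuple subr0.
Qed.

Lemma enorm_ge0 x : 0 <= enorm x. Proof. exact: sqrtr_ge0. Qed.

Lemma tnth_dilate t x i : tnth (tdilate t x) i = t * tnth x i.
Proof. by rewrite /tdilate tnth_mktuple. Qed.

Lemma enorm_dilate t x : 0 <= t -> enorm (tdilate t x) = t * enorm x.
Proof.
move=> t0; rewrite /enorm; under eq_bigr do rewrite tnth_dilate exprMn.
by rewrite -mulr_sumr sqrtrM ?sqr_ge0// sqrtr_sqr ger0_norm.
Qed.

Lemma measurable_enorm : measurable_fun [set: n.-tuple T] enorm.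
Proof.
apply: (measurableT_comp (f := @Num.sqrt R)).
  by apply: continuous_measurable_fun; exact: sqrt_continuous.
by apply: measurable_sum => i; apply: measurable_funX; exact: measurable_tnth.
Qed.

Lemma measurable_tball r : measurable (tball r).
Proof.
rewrite (_ : tball r = enorm @^-1` `]-oo, r[).
  by rewrite -[X in measurable X]setTI; exact: measurable_enorm.
by apply/seteqP; split => x /=; rewrite in_itv.
Qed.

Lemma tball_dilate t r : 0 < t -> tdilate t @^-1` tball r = tball (r / t).
Proof.
move=> t0; apply/seteqP; split => x; rewrite /tball/= enorm_dilate ?(ltW t0)//.
  by rewrite ltr_pdivlMr// mulrC.
by rewrite ltr_pdivlMr// mulrC.
Qed.

Definition vol1 : R := fine (mu (tball 1)).

Lemma measurable_rectangle (A : 'I_n -> set T) : (forall i, measurable (A i)) ->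
  measurable [set x : n.-tuple T | forall i, A i (tnth x i)].
Proof.
move=> mA; rewrite (_ : mkset _ = \bigcap_(i in [set: 'I_n])
    (fun x : n.-tuple T => tnth x i) @^-1` A i).
  apply: fin_bigcap_measurable; first exact: finite_finset.
  by move=> i _; rewrite -[X in measurable X]setTI; exact: (measurable_tnth i).
by apply/seteqP; split => [x Ax i _|x Ax i]; [exact: Ax | exact: (Ax i I)].
Qed.

Lemma product_lebesgue_cube (a b : R) : a <= b ->
  mu [set x | forall i, `]a, b[%classic (tnth x i)] = ((b - a) ^+ n)%:E.
Proof.
move=> ab; rewrite (@product_lebesgue_rectangle R n (fun=> `]a, b[%classic))//.
have -> : lebesgue_measure (`]a, b[%classic : set T) = (b - a)%:E.
  rewrite lebesgue_measure_itv/= lte_fin.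
  case: ltP => [_|ba]; first by rewrite EFinB.
  by rewrite (_ : b = a) ?subrr//; apply/eqP; rewrite eq_le ba ab.
by rewrite prodEFin prodr_const card_ord.
Qed.

Lemma tball1_fin_num : mu (tball 1) \is a fin_num.
Proof.
rewrite ge0_fin_numE//; apply: (@le_lt_trans _ _
  (mu [set x | forall i, `]-1, 1[%classic (tnth x i)])).
  apply: le_measure; rewrite ?inE; first exact: measurable_tball.
    exact: (@measurable_rectangle (fun=> `]-1, 1[%classic)).
  move=> x; rewrite /tball /enorm/= => x1 i.
  have : `|tnth x i| < 1.
    apply: le_lt_trans x1; rewrite -sqrtr_sqr ler_wsqrtr//.
    by rewrite (bigD1 i)//= lerDl sumr_ge0// => j _; exact: sqr_ge0.
  by rewrite in_itv/= ltr_norml.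
by rewrite product_lebesgue_cube ?ltey//; lra.
Qed.

Lemma vol1_gt0 : 0 < vol1.
Proof.
apply: fine_gt0; rewrite -ge0_fin_numE// tball1_fin_num andbT.
(* The cube (0, e)^n lies in the unit ball: since e < 1, the sum of squares is at most n e, which is
   less than 1. *)
pose e : R := n.+2%:R^-1.
have e0 : 0 < e by rewrite invr_gt0.
apply: (@lt_le_trans _ _ (mu [set x | forall i, `]0, e[%classic (tnth x i)])).
  by rewrite product_lebesgue_cube ?(ltW e0)// lte_fin exprn_gt0// subr0.
apply: le_measure; rewrite ?inE; [|exact: measurable_tball|].
  exact: (@measurable_rectangle (fun=> `]0, e[%classic)).
move=> x xe; rewrite /tball /enorm/= -sqrtr1 ltr_sqrt//.
apply: (@le_lt_trans _ _ (\sum_(i < n) e)).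
  apply: ler_sum => i _; have := xe i; rewrite /= in_itv/= => /andP[x0 xe'].
  rewrite expr2; apply: (@le_trans _ _ (1 * tnth x i)); last by rewrite mul1r ltW.
  by rewrite ler_wpM2r ?ltW// (lt_trans xe')// /e invf_lt1 ?ltr1n.
by rewrite big_const_ord iter_addr addr0 -mulr_natl /e ltr_pdivrMr// mul1r ltr_nat.
Qed.

Lemma product_lebesgue_tball r : 0 < r -> mu (tball r) = (vol1 * r ^+ n)%:E.
Proof.
move=> r0; have r1 : 0 < r^-1 by rewrite invr_gt0.
rewrite -[r in LHS]mul1r -[r in LHS]invrK -tball_dilate//.
rewrite product_lebesgue_dilate//; last exact: measurable_tball.
by rewrite exprVn invrK EFinM muleC /vol1 fineK// tball1_fin_num.
Qed.

End balls.

(** * Weighted AM-GM and Young's inequality *)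

Section weighted_amgm.
Context {R : realType} {I : finType}.
Implicit Types (a v : I -> R).

Lemma powR_sum (x : R) a : 0 < x -> x `^ (\sum_i a i) = \prod_i x `^ a i.
Proof.
move=> x0; by rewrite /powR gt_eqF// mulr_suml expR_sum.
Qed.

Lemma prod_powR (f : I -> R) (r : R) : (forall i, 0 <= f i) ->
  (\prod_i f i) `^ r = \prod_i f i `^ r.
Proof.
move=> f0; suff [] : (\prod_i f i) `^ r = \prod_i f i `^ r /\ 0 <= \prod_i f i by [].
apply: (big_rec2 (fun x y => x `^ r = y /\ 0 <= x)); first by rewrite powR1.
by move=> i y x _ [<- y0]; rewrite powRM// mulr_ge0.
Qed.

(** With s the weighted mean, ln y <= y - 1 at y = v_i / s gives (v_i / s)^(a_i) <= exp (a_i (v_i /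
    s - 1)); the product of these exponentials is 1. *)
Lemma weighted_amgm a v : (forall i, 0 < a i) -> \sum_i a i = 1 ->
  (forall i, 0 <= v i) -> \prod_i v i `^ a i <= \sum_i a i * v i.
Proof.
move=> a0 a1 v0; set s := \sum_i a i * v i.
have av0 i : true -> 0 <= a i * v i by move=> _; exact: mulr_ge0 (ltW (a0 i)) (v0 i).
have s_ge0 : 0 <= s by apply: sumr_ge0.
(* If the mean is 0, all v_i vanish; an index exists because the weights sum to 1, so the product is
   0. *)
have [s0|s_neq0] := eqVneq s 0.
  have [i _] : exists i : I, true.
    apply/existsP; apply: contraT; rewrite negb_exists => /forallP I0.
    by move: a1 (oner_neq0 R); rewrite big1 => [<-|i _]; [rewrite eqxx|have := I0 i].
  rewrite s0 (bigD1 i)//=.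
  have /eqP := s0; rewrite psumr_eq0// => /allP/(_ i (mem_index_enum i))/=.
  by rewrite mulf_eq0 gt_eqF//= => /eqP ->; rewrite powR0 ?gt_eqF// mul0r.
have s_gt0 : 0 < s by rewrite lt_neqAle eq_sym s_neq0.
have e1 : \prod_i expR (a i * (v i / s - 1)) = 1.
  rewrite -expR_sum; under eq_bigr do rewrite mulrBr mulr1 mulrA.
  by rewrite sumrB -mulr_suml -/s divff// a1 subrr expR0.
have se : \prod_i s `^ a i = s by rewrite -powR_sum// a1 powRr1.
apply: (@le_trans _ _ ((\prod_i expR (a i * (v i / s - 1))) * \prod_i s `^ a i)); last first.
  by rewrite e1 se mul1r.
rewrite -big_split/=; apply: ler_prod => i _; rewrite powR_ge0/=.
have [->|vi_neq0] := eqVneq (v i) 0.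
  by rewrite powR0 ?gt_eqF// mulr_ge0// ?expR_ge0// powR_ge0.
have vi_gt0 : 0 < v i by rewrite lt_neqAle eq_sym vi_neq0 v0.
rewrite -ler_pdivrMr ?powR_gt0//.
have -> : v i `^ a i / s `^ a i = (v i / s) `^ a i.
  by rewrite powRM ?invr_ge0// -(powR_inv1 s_ge0) -powRrM mulN1r powRN.
rewrite /powR gt_eqF ?divr_gt0// ler_expR ler_pM2l//.
have := @le_ln1Dx _ (v i / s - 1); rewrite (addrC 1) subrK; apply.
by rewrite ltrBrDr addNr divr_gt0.
Qed.

(** AM-GM with weights p / p_i, applied to u_i^(p_i). It stands in for Hoelder's inequality with
    several factors. *)
Lemma young_prod (p : R) (ps u : I -> R) : 0 < p -> (forall i, 0 < ps i) ->
  p^-1 = \sum_i (ps i)^-1 -> (forall i, 0 <= u i) ->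
  (\prod_i u i) `^ p <= \sum_i (p / ps i) * u i `^ ps i.
Proof.
move=> p0 ps0 pE u0; rewrite prod_powR//.
apply: le_trans (weighted_amgm _ _ _).
- apply: ler_prod => i _; rewrite powR_ge0/= -powRrM.
  by rewrite mulrC mulrAC -mulrA divff ?mulr1 ?gt_eqF.
- by move=> i; rewrite divr_gt0.
- by rewrite -mulr_sumr -pE divff// gt_eqF.
- by move=> i; exact: powR_ge0.
Qed.

End weighted_amgm.

(** * A Jensen inequality for weighted integrals *)

Section jensen.
Context d (T : measurableType d) (R : realType).
Variable mu : {measure set T -> \bar R}.
Local Open Scope ereal_scope.

(* Hoelder's inequality for u k^(1/p) and k^(1-1/p) *)
Lemma jensen_powR (u k : T -> R) (p : R) : (1 < p)%R ->
  measurable_fun setT u -> measurable_fun setT k ->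
  (forall x, 0 <= u x)%R -> (forall x, 0 <= k x)%R ->
  (\int[mu]_x (u x * k x)%:E) `^ p <=
  (\int[mu]_x (k x)%:E) `^ (p - 1) * \int[mu]_x (u x `^ p * k x)%:E.
Proof.
move=> p1 mu_ mk u0 k0; have p0 : (0 < p)%R by exact: lt_trans p1.
have p1' : (0 < p - 1)%R by rewrite subr_gt0.
pose q := (p / (p - 1))%R; have q0 : (0 < q)%R by rewrite divr_gt0.
have pq : (p^-1 + q^-1 = 1)%R.
  by rewrite /q invf_div -[X in (X + _)%R]div1r -mulrDl addrCA subrr addr0 divff// gt_eqF.
pose f x := (u x * k x `^ p^-1)%R; pose g x := (k x `^ q^-1)%R.
have f0 x : (0 <= f x)%R by rewrite mulr_ge0 ?powR_ge0.
have g0 x : (0 <= g x)%R by exact: powR_ge0.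
have mf : measurable_fun setT f.
  by apply: measurable_funM => //; exact: (measurableT_comp (measurable_powR _) mk).
have mg : measurable_fun setT g by exact: (measurableT_comp (measurable_powR _) mk).
have := hoelder mu mf mg p0 q0 pq.
rewrite Lnorm1 => H.
have {H} := gt0_ler_poweR (ltW p0) _ _ H.
rewrite !in_itv/= !leey !andbT integral_ge0// mule_ge0 ?Lnorm_ge0// => /(_ erefl erefl).
have -> : \int[mu]_x `|(EFin \o (f \* g)%R) x| = \int[mu]_x (u x * k x)%:E.
  apply: eq_integral => x _ /=; rewrite ger0_norm ?(mulr_ge0 (f0 x) (g0 x))// /f /g -mulrA.
  by rewrite -powRD ?pq ?oner_eq0// powRr1.
rewrite poweRM ?Lnorm_ge0// [X in _ <= X]muleC poweR_Lnorm ?gt_eqF//.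
have -> : \int[mu]_x `|(EFin \o f) x| `^ p = \int[mu]_x (u x `^ p * k x)%:E.
  apply: eq_integral => x _ /=; rewrite ger0_norm// /f.
  by rewrite powRM ?powR_ge0// -powRrM mulVf ?gt_eqF// powRr1.
suff -> : 'N[mu]_q%:E[EFin \o g] `^ p = (\int[mu]_x (k x)%:E) `^ (p - 1) by [].
have pE : (q * (p - 1) = p)%R by rewrite /q divfK// gt_eqF.
rewrite -[X in _ `^ X = _]pE poweRrM poweR_Lnorm ?gt_eqF//.
congr (_ `^ _); apply: eq_integral => x _ /=; rewrite ger0_norm// /g.
by rewrite -powRrM mulVf ?gt_eqF// powRr1.
Qed.

End jensen.

(** * Integral form of Minkowski's inequality *)

Section minkowski.
Context d1 d2 (X : measurableType d1) (T : measurableType d2) (R : realType).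
Variables (nu : {sigma_finite_measure set X -> \bar R}).
Variables (mu : {sigma_finite_measure set T -> \bar R}).
Local Open Scope ereal_scope.

(** Apply [jensen_powR] at each x, exchange the integrals by Tonelli and use the bound at each t:
    this leaves A^(p-1) A, where A is the integral of [k]. *)
Lemma integral_powR_average (U : X * T -> R) (k : T -> R) (p : R) : (1 < p)%R ->
  measurable_fun setT U -> measurable_fun setT k ->
  (forall z, 0 <= U z)%R -> (forall t, 0 <= k t)%R ->
  (forall t, k t != 0%R -> \int[nu]_x (U (x, t) `^ p)%:E <= 1) ->
  \int[nu]_x ((\int[mu]_t (U (x, t) * k t)%:E) `^ p) <=
  (\int[mu]_t (k t)%:E) `^ p.
Proof.
move=> p1 mU mk U0 k0 U1; have p0 : (0 < p)%R by exact: lt_trans p1.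
have mk2 : measurable_fun [set: X * T] (fun z => k z.2).
  exact: (measurableT_comp mk measurable_snd).
have mUk : measurable_fun [set: X * T] (fun z => (U z * k z.2)%:E).
  by apply/measurable_EFinP; exact: measurable_funM.
have mUpk : measurable_fun [set: X * T] (fun z => (U z `^ p * k z.2)%:E).
  apply/measurable_EFinP; apply: measurable_funM => //.
  exact: (measurableT_comp (measurable_powR _) mU).
have Uk0 z : 0 <= (U z * k z.2)%:E by rewrite lee_fin mulr_ge0.
have Upk0 z : 0 <= (U z `^ p * k z.2)%:E by rewrite lee_fin mulr_ge0 ?powR_ge0.
have mUpkF := @measurable_fun_fubini_tonelli_F _ _ _ _ _ mu _ mUpk Upk0.
have mUkF := @measurable_fun_fubini_tonelli_F _ _ _ _ _ mu _ mUk Uk0.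
pose A := \int[mu]_t (k t)%:E.
have A0 : 0 <= A by apply: integral_ge0 => t _; rewrite lee_fin.
apply: (@le_trans _ _ (\int[nu]_x (A `^ (p - 1) * \int[mu]_t (U (x, t) `^ p * k t)%:E))).
  apply: ge0_le_integral => //.
  - by move=> x _; exact: poweR_ge0.
  - exact: (measurableT_comp (measurable_poweR _) mUkF).
  - by apply: emeasurable_funM => //; exact: measurable_cst.
  - move=> x _; apply: jensen_powR => //.
    exact: (measurableT_comp mU (measurable_pair1 x)).
rewrite ge0_integralZl//; last 2 first.
- by move=> x _; apply: integral_ge0 => t _; exact: (Upk0 (x, t)).
- exact: poweR_ge0.
rewrite (fubini_tonelli (fun z => (U z `^ p * k z.2)%:E))//=.
apply: (@le_trans _ _ (A `^ (p - 1) * A)).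
  rewrite lee_wpmul2l ?poweR_ge0//; apply: ge0_le_integral => //.
  - by move=> t _; apply: integral_ge0 => x _; exact: (Upk0 (x, t)).
  - exact: (@measurable_fun_fubini_tonelli_G _ _ _ _ _ nu _ mUpk Upk0).
  - exact/measurable_EFinP.
  - move=> t _; under eq_integral do rewrite mulrC EFinM.
    rewrite ge0_integralZl//; last 3 first.
    + apply/measurable_EFinP; apply: (measurableT_comp (measurable_powR _)).
      exact: (measurableT_comp mU (measurable_pair2 t)).
    + by move=> x _; rewrite lee_fin powR_ge0.
    + by rewrite lee_fin.
    have [->|kt0] := eqVneq (k t) 0%R; first by rewrite mul0e.
    by rewrite -[leRHS]mule1 lee_wpmul2l ?lee_fin// U1.
rewrite -[X in _ * X]poweRe1// -poweRD ?subrK//.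
by apply: add_neq0_poweRD_def; rewrite subrK gt_eqF.
Qed.

End minkowski.

(** * The upper estimate for nonnegative Borel functions *)

Section hardy_bound_borel.
Context {R : realType} {n : nat}.
Local Open Scope classical_set_scope.
Local Notation T := (measurableTypeR R).
Local Notation mu := (product_lebesgue R).

Definition ball_volume (r : R) : R := @vol1 R n * r ^+ n.

Lemma ball_volume_gt0 r : 0 < r -> 0 < ball_volume r.
Proof. by move=> r0; rewrite mulr_gt0 ?vol1_gt0 ?exprn_gt0. Qed.

Lemma ball_volumeM s r : ball_volume (s * r) = ball_volume r * s ^+ n.
Proof. by rewrite /ball_volume exprMn; ring. Qed.

Lemma measurable_fun_dilatel (a : n.-tuple T -> R) (s : R) :
  measurable_fun setT a -> measurable_fun setT (fun x => a (tdilate s x)).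
Proof. by move=> ma; exact: (measurableT_comp ma (measurable_dilatel s)). Qed.

(** The substitution x -> s x moves the integral to the ball of radius s r, where the Morrey bound
    applies; the divisor is chosen so that all powers of s and of the volume cancel. *)
Lemma dilated_factor_bound (a : n.-tuple T -> R) (q lam M r s : R) :
  0 < q -> 0 < M -> 0 < r -> 0 < s ->
  measurable_fun setT a -> (forall x, 0 <= a x) ->
  (\int[mu n]_(x in tball (s * r)) (a x `^ q)%:E <=
     (ball_volume (s * r) `^ (1 + lam * q) * M `^ q)%:E)%E ->
  (\int[mu n]_(x in tball r)
    ((a (tdilate s x) / (M * ball_volume r `^ (lam + q^-1) * s `^ (n%:R * lam))) `^ q)%:E
     <= 1)%E.
Proof.
move=> q0 M0 r0 s0 ma a0 H; set c := M * _ * _.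
have V0 := ball_volume_gt0 r0.
have c0 : 0 < c by rewrite !mulr_gt0// powR_gt0.
have mas : measurable_fun setT (fun x => (a (tdilate s x) `^ q)%:E).
  apply/measurable_EFinP; apply: (measurableT_comp (measurable_powR _)).
  exact: measurable_fun_dilatel.
have maq : measurable_fun setT (fun x => (a x `^ q)%:E).
  by apply/measurable_EFinP; exact: (measurableT_comp (measurable_powR _)).
under eq_integral => x _.
  rewrite powRM ?invr_ge0 ?(ltW c0)// mulrC EFinM; over.
rewrite ge0_integralZl//; last 4 first.
- exact: measurable_tball.
- exact: measurable_funTS.
- by move=> x _; rewrite lee_fin powR_ge0.
- by rewrite lee_fin powR_ge0.
have tb : tball r = tdilate s @^-1` tball (s * r) :> set (n.-tuple T).
  by rewrite tball_dilate// mulrAC divff ?mul1r// gt_eqF.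
rewrite tb (ge0_integral_dilate (h := fun x => (a x `^ q)%:E))//; last 3 first.
- exact: measurable_tball.
- exact: measurable_funTS.
- by move=> x _; rewrite lee_fin powR_ge0.
apply: (@le_trans _ _ ((c^-1 `^ q)%:E * ((s ^- n)%:E *
    (ball_volume (s * r) `^ (1 + lam * q) * M `^ q)%:E))%E).
  rewrite lee_wpmul2l ?lee_fin ?powR_ge0// lee_wpmul2l// lee_fin invr_ge0.
  by rewrite exprn_ge0// ltW.
(* What remains is c^q = s^-n |B(0, s r)|^(1 + lam q) M^q, by |B(0, s r)| = s^n |B(0, r)|. *)
rewrite -!EFinM lee_fin.
have -> : c^-1 `^ q = (c `^ q)^-1.
  by rewrite -(powR_inv1 (ltW c0)) -powRrM mulN1r powRN.
rewrite mulrC ler_pdivrMr ?powR_gt0// mul1r.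
rewrite ball_volumeM /c; move: (ball_volume r) V0 => V V0.
rewrite !powRM ?mulr_ge0 ?powR_ge0 ?(ltW M0) ?(ltW V0) ?exprn_ge0 ?(ltW s0)//.
rewrite -[s ^+ n in X in X <= _]powR_mulrn ?(ltW s0)// -!powRrM.
rewrite mulrDl mulVf ?gt_eqF// (addrC (lam * q)).
rewrite mulrDr mulr1 [s `^ (_ + _)]powRD ?(gt_eqF s0) ?implybT//.
rewrite powR_mulrn ?(ltW s0)//.
have sn0 : s ^+ n != 0 by rewrite expf_neq0// gt_eqF.
rewrite (mulrA n%:R); set u := s `^ _; set v := V `^ _; set w := M `^ q.
by rewrite [leLHS](_ : _ = w * v * u)//; field.
Qed.

Context {m : nat}.
Variables (a : 'I_m -> n.-tuple T -> R) (w : m.-tuple T -> R).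
Variables (p : R) (ps lams M : 'I_m -> R).
Hypotheses (p_gt1 : 1 < p) (ps_gt0 : forall i, 0 < ps i).
Hypothesis p_def : p^-1 = \sum_(i < m) (ps i)^-1.
Hypotheses (ma : forall i, measurable_fun setT (a i)) (a_ge0 : forall i x, 0 <= a i x).
Hypotheses (mw : measurable_fun setT w) (w_ge0 : forall t, 0 <= w t).
Hypothesis w_supp : forall t, w t != 0 -> forall i, 0 < tnth t i.
Hypothesis M_gt0 : forall i, 0 < M i.
Hypothesis a_bound : forall i r, 0 < r ->
  (\int[mu n]_(x in tball r) (a i x `^ ps i)%:E <=
     (ball_volume r `^ (1 + lams i * ps i) * M i `^ ps i)%:E)%E.

(** The integrand of the constant A, with [w] in place of [omega]; see [hardy_constantE]. *)
Definition hardy_weight (t : m.-tuple T) : R :=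
  (\prod_(i < m) tnth t i `^ (n%:R * lams i)) * w t.

(** For [a i] the modulus of the i-th function, this is the modulus of the operator's integrand; see
    [normc_borel_integrand]. *)
Definition hardy_kernel (z : n.-tuple T * m.-tuple T) : R :=
  (\prod_(i < m) a i (tdilate (tnth z.2 i) z.1)) * w z.2.

Lemma hardy_weight_ge0 t : 0 <= hardy_weight t.
Proof. by rewrite mulr_ge0// prodr_ge0// => i _; exact: powR_ge0. Qed.

Lemma hardy_kernel_ge0 z : 0 <= hardy_kernel z.
Proof. by rewrite mulr_ge0// prodr_ge0. Qed.

Lemma measurable_hardy_weight : measurable_fun setT hardy_weight.
Proof.
apply: measurable_funM => //; apply: measurable_prod => i _.
by apply: (measurableT_comp (measurable_powR _)); exact: measurable_tnth.
Qed.

Lemma measurable_tdilate_tnth (i : 'I_m) :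
  measurable_fun [set: n.-tuple T * m.-tuple T] (fun z => tdilate (tnth z.2 i) z.1).
Proof.
apply: (measurableT_comp (@measurable_dilate R n)
  (f := fun tx => tdilate tx.1 tx.2) (g := fun z => (tnth z.2 i, z.1))).
apply/measurable_fun_pairP; split; last exact: measurable_fst.
exact: (measurableT_comp (measurable_tnth i) measurable_snd).
Qed.

Lemma measurable_hardy_kernel : measurable_fun setT hardy_kernel.
Proof.
apply: measurable_funM; last exact: (measurableT_comp mw measurable_snd).
apply: measurable_prod => i _.
exact: (measurableT_comp (ma i) (measurable_tdilate_tnth i)).
Qed.

Lemma hardy_bound_borel r : 0 < r ->
  (\int[mu n]_(x in tball r) ((\int[mu m]_t (hardy_kernel (x, t))%:E) `^ p) <=
   ((ball_volume r `^ (\sum_i lams i + p^-1) * \prod_i M i) `^ p)%:E *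
   (\int[mu m]_t (hardy_weight t)%:E) `^ p)%E.
Proof.
move=> r0; have V0 := ball_volume_gt0 r0.
have p0 : 0 < p by exact: lt_trans p_gt1.
(* The share of the i-th factor in the constant: these multiply to [C] because the 1/p_i add up to
   1/p. *)
pose c i := M i * ball_volume r `^ (lams i + (ps i)^-1).
have c0 i : 0 < c i by rewrite mulr_gt0// powR_gt0.
set C := ball_volume r `^ _ * _.
have CE : C = \prod_i c i.
  by rewrite /C p_def -big_split/= powR_sum// -big_split/=; apply: eq_bigr => i _; rewrite mulrC.
have C0 : 0 < C by rewrite CE prodr_gt0.
(* Normalized so that, for t in the support of [w], the integral of its p_i-th power over the ball
   is at most 1. *)
pose u i (z : n.-tuple T * m.-tuple T) :=
  a i (tdilate (tnth z.2 i) z.1) / (c i * tnth z.2 i `^ (n%:R * lams i)).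
have u0 i z : 0 <= u i z by rewrite divr_ge0// mulr_ge0 ?powR_ge0// ltW.
have mu_ i : measurable_fun setT (u i).
  rewrite (_ : u i = fun z => a i (tdilate (tnth z.2 i) z.1) *
      ((c i)^-1 * tnth z.2 i `^ (- (n%:R * lams i)))); last first.
    by apply/funext => z; rewrite powRN -invfM.
  apply: measurable_funM.
    exact: (measurableT_comp (ma i) (measurable_tdilate_tnth i)).
  apply: measurable_funM => //; apply: (measurableT_comp (measurable_powR _)).
  exact: (measurableT_comp (measurable_tnth i) measurable_snd).
pose U z := \1_(tball r) z.1 * \prod_i u i z.
have U0 z : 0 <= U z by rewrite mulr_ge0// ?indicE// prodr_ge0.
have mU : measurable_fun setT U.
  apply: measurable_funM; last exact: measurable_prod.
  apply: (measurableT_comp _ measurable_fst).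
  by apply: measurable_indic; exact: measurable_tball.
(* Young's inequality dominates U^p by a combination of the u_i^(p_i) whose weights p / p_i sum to
   1. *)
have U1 t : hardy_weight t != 0 -> (\int[mu n]_x (U (x, t) `^ p)%:E <= 1)%E.
  rewrite /hardy_weight mulf_eq0 negb_or => /andP[_ /w_supp t0].
  have mut i : measurable_fun setT (fun x => (u i (x, t) `^ ps i)%:E).
    apply/measurable_EFinP; apply: (measurableT_comp (measurable_powR _)).
    exact: (measurableT_comp (mu_ i) (measurable_pair2 t)).
  have uint i : (\int[mu n]_(x in tball r) (u i (x, t) `^ ps i)%:E <= 1)%E.
    rewrite /u /=.
    exact: (dilated_factor_bound (ps_gt0 i) (M_gt0 i) r0 (t0 i) (ma i) (a_ge0 i)
      (a_bound i (mulr_gt0 (t0 i) r0))).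
  have pps0 i : 0 <= p / ps i by rewrite divr_ge0 ?ltW.
  apply: (@le_trans _ _ (\int[mu n]_(x in tball r)
      (\sum_(i < m) (p / ps i)%:E * (u i (x, t) `^ ps i)%:E))%E).
    rewrite [leRHS]integral_mkcond; apply: ge0_le_integral => //.
    - by move=> x _; rewrite lee_fin powR_ge0.
    - apply/measurable_EFinP; apply: (measurableT_comp (measurable_powR _)).
      exact: (measurableT_comp mU (measurable_pair2 t)).
    - apply/(measurable_restrictT _ (measurable_tball r)).
      apply: measurable_funTS; apply: emeasurable_sum => i.
      by apply: emeasurable_funM => //; exact: measurable_cst.
    - move=> x _; rewrite patchE /U indicE.
      case: ifPn => xr /=; last by rewrite mul0r powR0// gt_eqF.
      rewrite mul1r.
      by rewrite sumEFin lee_fin young_prod.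
  rewrite ge0_integral_sum//; last 3 first.
  - exact: measurable_tball.
  - move=> i; apply: measurable_funTS.
    by apply: emeasurable_funM => //; exact: measurable_cst.
  - by move=> i x _; rewrite -EFinM lee_fin mulr_ge0 ?powR_ge0.
  apply: (@le_trans _ _ (\sum_(i < m) (p / ps i)%:E)%E).
    apply: lee_sum => i _; rewrite ge0_integralZl//; last 4 first.
    + exact: measurable_tball.
    + exact: measurable_funTS (mut i).
    + by move=> x _; rewrite lee_fin powR_ge0.
    + by rewrite lee_fin.
    by rewrite -[leRHS]mule1 lee_wpmul2l// lee_fin.
  by rewrite sumEFin lee_fin -mulr_sumr -p_def divff// gt_eqF.
have mUk : measurable_fun setT (fun z => (U z * hardy_weight z.2)%:E).
  apply/measurable_EFinP; apply: measurable_funM => //.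
  exact: (measurableT_comp measurable_hardy_weight measurable_snd).
have Uk0 z : (0 <= (U z * hardy_weight z.2)%:E)%E.
  by rewrite lee_fin mulr_ge0 ?hardy_weight_ge0.
have mF := @measurable_fun_fubini_tonelli_F _ _ _ _ _ (mu m) _ mUk Uk0.
have mFp : measurable_fun setT
    (fun x => ((\int[mu m]_t (U (x, t) * hardy_weight t)%:E) `^ p)%E).
  exact: (measurableT_comp (measurable_poweR _) mF).
apply: (@le_trans _ _ (\int[mu n]_(x in tball r)
    ((C `^ p)%:E * (\int[mu m]_t (U (x, t) * hardy_weight t)%:E) `^ p))%E).
  rewrite le_eqVlt; apply/orP; left; apply/eqP.
  apply: eq_integral => x /set_mem xr.
  rewrite -poweR_EFin -poweRM ?lee_fin ?(ltW C0)//; last exact: integral_ge0.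
  rewrite -ge0_integralZl//; last 2 first.
  - exact: (measurableT_comp mUk (measurable_pair1 x)).
  - by rewrite lee_fin ltW.
  congr (_ `^ _)%E; apply: eq_integral => t _; rewrite -EFinM; congr (_%:E).
  rewrite /hardy_kernel /hardy_weight /U indicE mem_set//= mul1r.
  have [->|wt0] := eqVneq (w t) 0; first by rewrite !mulr0.
  rewrite !mulrA; congr (_ * _); rewrite CE -!big_split/=.
  apply: eq_bigr => i _; have ti := w_supp wt0 i.
  rewrite /u/=; field.
  by rewrite !gt_eqF// powR_gt0.
rewrite ge0_integralZl//; last 4 first.
- exact: measurable_tball.
- exact: measurable_funTS.
- by move=> x _; exact: poweR_ge0.
- by rewrite lee_fin powR_ge0.
rewrite lee_wpmul2l ?lee_fin ?powR_ge0//.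
apply: (@le_trans _ _ (\int[mu n]_x
    ((\int[mu m]_t (U (x, t) * hardy_weight t)%:E) `^ p))%E).
  apply: ge0_subset_integral => //; first exact: measurable_tball.
  by move=> x _; exact: poweR_ge0.
apply: integral_powR_average => //; first exact: measurable_hardy_weight.
exact: hardy_weight_ge0.
Qed.

End hardy_bound_borel.

(** * Modulus, measurability and integrals of complex functions *)

Section complex_functions.
Context d (T : measurableType d) (R : realType).
Local Open Scope classical_set_scope.
Local Notation normc := (@Normc.normc R).
Implicit Types (f : T -> R[i]) (z : R[i]).

Lemma normc_ge0 z : 0 <= normc z.
Proof. by case: z => a b; exact: sqrtr_ge0. Qed.

Lemma normr_Re_le z : `|complex.Re z| <= normc z.
Proof. by case: z => a b /=; rewrite -sqrtr_sqr ler_wsqrtr// lerDl sqr_ge0. Qed.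

Lemma normr_Im_le z : `|complex.Im z| <= normc z.
Proof. by case: z => a b /=; rewrite -sqrtr_sqr ler_wsqrtr// lerDr sqr_ge0. Qed.

Lemma normc_real (a : R) : 0 <= a -> normc a%:C%C = a.
Proof. by move=> a0; rewrite /Normc.normc/= expr0n/= addr0 sqrtr_sqr ger0_norm. Qed.

Lemma normc_prod (I : Type) (s : seq I) (F : I -> R[i]) :
  normc (\prod_(i <- s) F i) = \prod_(i <- s) normc (F i).
Proof. by apply: big_morph; [exact: Normc.normcM|exact: Normc.normc1]. Qed.

Lemma prod_real_complex (I : Type) (s : seq I) (F : I -> R) :
  \prod_(i <- s) (F i)%:C%C = (\prod_(i <- s) F i)%:C%C :> R[i].
Proof.
elim: s => [|i s IH]; rewrite ?big_nil// !big_cons IH.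
by apply/eqP; rewrite eq_complex/=; apply/andP; split; apply/eqP; ring.
Qed.

Lemma cauchy_schwarz2 (a b x y : R) : `|a * x + b * y| <=
  Num.sqrt (a ^+ 2 + b ^+ 2) * Num.sqrt (x ^+ 2 + y ^+ 2).
Proof.
rewrite -sqrtrM ?addr_ge0 ?sqr_ge0// -sqrtr_sqr ler_wsqrtr// -subr_ge0.
rewrite [X in 0 <= X](_ : _ = (a * y - b * x) ^+ 2) ?sqr_ge0//; ring.
Qed.

Lemma cmeasurable_prod (I : Type) (s : seq I) (F : I -> T -> R[i]) :
  (forall i, cmeasurable setT (F i)) ->
  cmeasurable setT (fun x => \prod_(i <- s) F i x).
Proof.
move=> mF; elim: s => [|i s [mRe mIm]].
  split.
    rewrite [X in measurable_fun _ X](_ : _ = cst 1); first exact: measurable_cst.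
    by apply/funext => x; rewrite big_nil.
  rewrite [X in measurable_fun _ X](_ : _ = cst 0); first exact: measurable_cst.
  by apply/funext => x; rewrite big_nil.
have [mReF mImF] := mF i; split.
- rewrite [X in measurable_fun _ X](_ : _ = (fun x =>
    complex.Re (F i x) * complex.Re (\prod_(j <- s) F j x) -
    complex.Im (F i x) * complex.Im (\prod_(j <- s) F j x))).
    by apply: measurable_funB; exact: measurable_funM.
  by apply/funext => x; rewrite big_cons; case: (F i x) => ? ?; case: (\prod_(j <- s) _).
- rewrite [X in measurable_fun _ X](_ : _ = (fun x =>
    complex.Re (F i x) * complex.Im (\prod_(j <- s) F j x) +
    complex.Im (F i x) * complex.Re (\prod_(j <- s) F j x))).
    by apply: measurable_funD; exact: measurable_funM.
  by apply/funext => x; rewrite big_cons; case: (F i x) => ? ?; case: (\prod_(j <- s) _).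
Qed.

Lemma measurable_normc D f : cmeasurable D f -> measurable_fun D (normc \o f).
Proof.
move=> [mRe mIm].
rewrite (_ : _ \o _ = fun x => Num.sqrt (complex.Re (f x) ^+ 2 + complex.Im (f x) ^+ 2)).
  apply: (measurableT_comp (f := @Num.sqrt R)).
    by apply: continuous_measurable_fun; exact: sqrt_continuous.
  by apply: measurable_funD; exact: measurable_funX.
by apply/funext => x /=; case: (f x).
Qed.

Variable mu : {measure set T -> \bar R}.

(* With a + ib the integral, a^2 + b^2 is the integral of a Re f + b Im f. *)
Lemma normc_cintegral_le D f : measurable D -> cintegrable mu D f ->
  ((normc (cintegral mu D f))%:E <= \int[mu]_(x in D) (normc (f x))%:E)%E.
Proof.
move=> mD [iRe iIm]; rewrite /cintegral /=.
set a := Rintegral _ _ _; set b := Rintegral _ _ _.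
set c := Num.sqrt _.
have [c0|c_neq0] := eqVneq c 0.
  by rewrite c0 integral_ge0// => x _; rewrite lee_fin normc_ge0.
have c_gt0 : 0 < c by rewrite lt_neqAle eq_sym c_neq0 sqrtr_ge0.
have mRe : measurable_fun D (fun x => complex.Re (f x)).
  by apply/measurable_EFinP; exact: (measurable_int mu).
have mIm : measurable_fun D (fun x => complex.Im (f x)).
  by apply/measurable_EFinP; exact: (measurable_int mu).
have mn : measurable_fun D (fun x => (normc (f x))%:E).
  by apply/measurable_EFinP; exact: (measurable_normc (f := f)).
have iRe' : mu.-integrable D (EFin \o (fun x => a * complex.Re (f x))).
  by have := integrableZl mD a iRe.
have iIm' : mu.-integrable D (EFin \o (fun x => b * complex.Im (f x))).
  by have := integrableZl mD b iIm.
have iD : mu.-integrable D (fun x => (a * complex.Re (f x) + b * complex.Im (f x))%:E).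
  by have := integrableD mD iRe' iIm'.
have E : (c * c)%:E =
    (\int[mu]_(x in D) (a * complex.Re (f x) + b * complex.Im (f x))%:E)%E.
  rewrite -expr2 sqr_sqrtr ?addr_ge0 ?sqr_ge0//.
  rewrite -[RHS]fineK; last exact: integrable_fin_num.
  congr (_%:E); rewrite -[RHS]/(Rintegral mu D _) RintegralD// !RintegralZl//.
rewrite -(@lee_pmul2l _ c%:E)// -EFinM E -ge0_integralZl//; last 2 first.
- by move=> x _; rewrite lee_fin normc_ge0.
- by rewrite lee_fin ltW.
apply: (le_trans (lee_abs _)); apply: (le_trans (le_abse_integral _ _ _)) => //.
  exact: measurable_int iD.
apply: ge0_le_integral => //.
- by apply: measurableT_comp => //; exact: measurable_int iD.
- by apply: emeasurable_funM => //; exact: measurable_cst.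
- by move=> x _; rewrite -EFinM lee_fin; case: (f x) => u v; exact: cauchy_schwarz2.
Qed.

End complex_functions.

(** * Integrals modulo null sets *)

Section mod_null.
Context {R : realType} {n : nat}.
Local Open Scope classical_set_scope.
Local Notation Tn := (n.-tuple (measurableTypeR R)).
Local Notation mu := (product_lebesgue R n).
Local Notation leb := (lebesgue_Rn R n).
Variables (N D : set Tn).
Hypotheses (mN : measurable N) (N0 : mu N = 0%E) (mD : measurable D).

Lemma integral_Rn_mod_null (F G : Tn -> \bar R) :
  measurable_fun setT G -> (forall x, ~ N x -> F x = G x) ->
  (\int[leb]_(x in D) F x = \int[leb]_(x in D) G x)%E.
Proof.
move=> mG FG.
apply: (@ae_eq_integral _ _ _ leb D (G : Rn R n -> \bar R) (F : Rn R n -> \bar R)).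
- exact: measurable_Rn.
- by apply: measurable_funTS; exact: (measurable_fun_Rn_mod_null mN N0 mG FG).
- by apply: measurable_funTS; exact: measurable_funT_Rn.
- have := negligible_Rn mN N0; apply: negligibleS => x /= nFG.
  by apply: contrapT => Nx; apply: nFG => _; exact: FG.
Qed.

Lemma ge0_integral_Rn_mod_null (F G : Tn -> \bar R) :
  measurable_fun setT G -> (forall x, ~ N x -> F x = G x) ->
  (forall x, 0 <= G x)%E ->
  (\int[leb]_(x in D) F x = \int[mu]_(x in D) G x)%E.
Proof.
move=> mG FG G0; rewrite (integral_Rn_mod_null mG FG) ge0_integral_lebesgue_Rn//.
exact: measurable_funTS.
Qed.

End mod_null.

(** * Borel versions of functions, and null sets under dilation *)

Section null_sets.
Context {R : realType}.
Local Open Scope classical_set_scope.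
Local Notation T := (measurableTypeR R).
Local Notation mu := (product_lebesgue R).

Lemma null_bigcup_fin d (X : measurableType d) (nu : {measure set X -> \bar R})
    (I : finType) (Z : I -> set X) :
  (forall i, measurable (Z i) /\ nu (Z i) = 0%E) ->
  measurable (\bigcup_i Z i) /\ nu (\bigcup_i Z i) = 0%E.
Proof.
move=> Z0; have mZ : measurable (\bigcup_i Z i).
  by apply: fin_bigcup_measurable => // i _; have [] := Z0 i.
split => //; apply/negligibleP => //.
(* The finite family becomes a sequence through [pickle], padded with empty sets. *)
pose Z' k := if unpickle k is Some i then Z i else set0.
apply: (@negligibleS _ _ _ _ (\bigcup_k Z' k)).
  by move=> x [i _ Zix]; exists (pickle i) => //; rewrite /Z' pickleK.
apply: negligible_bigcup => k; rewrite /Z'; case: (unpickle k) => [i|].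
  by have [mZi Zi0] := Z0 i; apply/negligibleP.
exact: negligible_set0.
Qed.

Lemma borel_modification n (f : Rn R n -> R[i]) : cmeasurable setT f ->
  exists N g, [/\ measurable N, mu n N = 0%E,
    cmeasurable [set: n.-tuple T] g & forall x, ~ N x -> f x = g x].
Proof.
move=> [mRe mIm].
have [N1 [mN1 N10 mg1]] := caratheodory_measurable_fun_mod_null mRe.
have [N2 [mN2 N20 mg2]] := caratheodory_measurable_fun_mod_null mIm.
exists (N1 `|` N2), (fun x => Complex (if x \in N1 then 0 else complex.Re (f x))
  (if x \in N2 then 0 else complex.Im (f x))); split => //.
- exact: measurableU.
- by rewrite measureU0.
- move=> x /not_orP[x1 x2]; rewrite !memNset//.
  by case: (f x).
Qed.

Lemma measurable_open_cube m : measurable (open_cube : set (m.-tuple T)).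
Proof.
rewrite (_ : open_cube = [set x : m.-tuple T | forall i, `]0, 1[%classic (tnth x i)]).
  exact: (@measurable_rectangle R m (fun=> `]0, 1[%classic)).
by apply/seteqP; split => x x01 i; have := x01 i; rewrite /= in_itv.
Qed.

Lemma measurable_closed_cube m : measurable (closed_cube : set (m.-tuple T)).
Proof.
rewrite (_ : closed_cube = [set x : m.-tuple T | forall i, `[0, 1]%classic (tnth x i)]).
  exact: (@measurable_rectangle R m (fun=> `[0, 1]%classic)).
by apply/seteqP; split => x x01 i; have := x01 i; rewrite /= in_itv.
Qed.

Lemma open_closed_cube m : @open_cube R m `<=` closed_cube.
Proof. by move=> x x01 i; have /andP[x0 x1] := x01 i; rewrite !ltW. Qed.

(** Restricting [omega] to the open cube before the modification puts the cube into the support of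
    [w], so that later integrals in t can run over the whole space. *)
Lemma weight_modification m (omega : Rn R m -> R) :
  (forall t, closed_cube t -> 0 <= omega t) ->
  (lebesgue_Rn R m).-integrable closed_cube (fun t => (omega t)%:E) ->
  exists N (w : m.-tuple T -> R), [/\ measurable N, mu m N = 0%E, measurable_fun setT w,
    (forall t, 0 <= w t) /\ (forall t, w t != 0 -> open_cube (t : Rn R m)) &
    forall t, ~ N t -> open_cube (t : Rn R m) -> omega t = w t].
Proof.
move=> om0 iom.
have mom : measurable_fun (open_cube : set (Rn R m)) omega.
  apply: (@measurable_funS _ _ _ _ closed_cube).
  - exact: measurable_Rn (@measurable_closed_cube m).
  - exact: (@open_closed_cube m).
  - by apply/measurable_EFinP; exact: measurable_int iom.
have mop := measurable_Rn (@measurable_open_cube m).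
have := (measurable_restrictT omega mop).1 mom.
move=> /caratheodory_measurable_fun_mod_null[N [mN N0 mw]].
exists N, (fun t => if t \in N then 0 else (omega \_ open_cube) t); split => //.
- split => t; case: ifPn => // _; rewrite ?eqxx// patchE; case: ifPn => //.
  + by move=> /set_mem /open_closed_cube; exact: om0.
  + by move=> /set_mem.
  + by rewrite eqxx.
- by move=> t Nt tc; rewrite memNset// patchE mem_set.
Qed.

(** Let [Q] be the set of (x, t) with t_i > 0 and t_i x in [N]. Its sections at fixed t are null,
    being empty or preimages of a null set by a dilation; by Tonelli almost all its sections at
    fixed x are null. *)
Lemma null_dilation n m (i : 'I_m) (N : set (n.-tuple T)) :
  measurable N -> mu n N = 0%E ->
  exists Z, [/\ measurable Z, mu n Z = 0%E & forall x, ~ Z x ->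
    exists M, (measurable M /\ mu m M = 0%E) /\
      forall t, ~ M t -> 0 < tnth t i -> ~ N (tdilate (tnth t i) x)].
Proof.
move=> mN N0.
pose Q : set (n.-tuple T * m.-tuple T) :=
  [set z | 0 < tnth z.2 i /\ N (tdilate (tnth z.2 i) z.1)].
have mQ : measurable Q.
  have -> : Q = ((fun z => tnth z.2 i) @^-1` `]0, +oo[) `&`
      ((fun z => tdilate (tnth z.2 i) z.1) @^-1` N).
    by apply/seteqP; split => z; rewrite /Q/= in_itv/= andbT.
  apply: measurableI; rewrite -[X in measurable X]setTI.
    exact: (measurableT_comp (measurable_tnth i) measurable_snd).
  exact: (measurable_tdilate_tnth i).
have mQ1 : measurable_fun setT (fun z => (\1_Q z)%:E : \bar R).
  by apply/measurable_EFinP; exact: measurable_indic.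
have Q0 z : (0 <= (\1_Q z)%:E :> \bar R)%E by rewrite lee_fin indicE.
pose h x := (\int[mu m]_t (\1_Q (x, t))%:E)%E.
have mh : measurable_fun setT h.
  exact: (@measurable_fun_fubini_tonelli_F _ _ _ _ _ (mu m) _ mQ1 Q0).
have hE x : h x = mu m (xsection Q x).
  rewrite /h -[xsection Q x]setIT -integral_indic//; last exact: measurable_xsection.
  by apply: eq_integral => t _; rewrite !indicE mem_xsection.
have : (\int[mu n]_x h x = 0)%E.
  rewrite /h (@fubini_tonelli _ _ _ _ _ (mu n) (mu m) (fun z => (\1_Q z)%:E))//.
  apply: integral0_eq => t _.
  have [t0|t0] := ltP 0 (tnth t i); last first.
    by apply: integral0_eq => x _; rewrite indicE memNset// => -[/=]; rewrite ltNge t0.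
  transitivity (\int[mu n]_x (\1_(tdilate (tnth t i) @^-1` N) x)%:E)%E.
    apply: eq_integral => x _; rewrite !indicE; congr ((nat_of_bool _)%:R%:E).
    by apply/idP/idP => [/set_mem[_ ?]|/set_mem ?]; apply/mem_set.
  have mtN : measurable (tdilate (tnth t i) @^-1` N : set (n.-tuple T)).
    by rewrite -[X in measurable X]setTI; exact: measurable_dilatel.
  rewrite integral_indic// setIT; apply: (etrans (product_lebesgue_dilate t0 mN)).
  by rewrite N0 mule0.
move=> h0; have : (\int[mu n]_x `|h x| = 0)%E.
  rewrite -[RHS]h0; apply: eq_integral => x _; rewrite gee0_abs//.
  by apply: integral_ge0 => t _; exact: (Q0 (x, t)).
move=> /(ae_eq_integral_abs _ measurableT mh)[Z [mZ Z0 hZ]].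
exists Z; split => // x Zx; exists (xsection Q x); split.
  split; first exact: measurable_xsection.
  rewrite -hE; apply: contrapT => hx; apply: Zx; apply: hZ => /=.
  by move=> /(_ I).
by move=> t Qt t0 Nt; apply: Qt; rewrite /xsection/=; apply/mem_set.
Qed.

Lemma null_dilations n m (N : 'I_m -> set (n.-tuple T)) :
  (forall i, measurable (N i) /\ mu n (N i) = 0%E) ->
  exists Z, [/\ measurable Z, mu n Z = 0%E & forall x, ~ Z x ->
    exists M, [/\ measurable M, mu m M = 0%E & forall t, ~ M t ->
      (forall i, 0 < tnth t i) -> forall i, ~ N i (tdilate (tnth t i) x)]].
Proof.
move=> N0.
have /choice[Z ZP] : forall i, exists Z, [/\ measurable Z, mu n Z = 0%E & forall x, ~ Z x ->
    exists M, (measurable M /\ mu m M = 0%E) /\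
      forall t, ~ M t -> 0 < tnth t i -> ~ N i (tdilate (tnth t i) x)].
  by move=> i; have [mNi Ni0] := N0 i; exact: null_dilation.
have [mZ Z0] : measurable (\bigcup_i Z i) /\ mu n (\bigcup_i Z i) = 0%E.
  by apply: null_bigcup_fin => i; have [] := ZP i.
exists (\bigcup_i Z i); split => // x Zx.
have /choice[M MP] : forall i, exists M, (measurable M /\ mu m M = 0%E) /\
      forall t, ~ M t -> 0 < tnth t i -> ~ N i (tdilate (tnth t i) x).
  by move=> i; have [_ _] := ZP i; apply => Zix; apply: Zx; exists i.
have [mM M0] : measurable (\bigcup_i M i) /\ mu m (\bigcup_i M i) = 0%E.
  by apply: null_bigcup_fin => i; have [] := MP i.
exists (\bigcup_i M i); split => // t Mt t0 i; have [_] := MP i; apply => //.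
by move=> Mit; apply: Mt; exists i.
Qed.

End null_sets.

(** * The operator in terms of Borel versions of its data *)

Section hardy_modification.
Context {R : realType} {n m : nat}.
Local Open Scope classical_set_scope.
Local Notation T := (measurableTypeR R).
Local Notation mu := (product_lebesgue R).
Local Notation normc := (@Normc.normc R).

Lemma integral_lebesgue_Rn k (F : k.-tuple T -> \bar R) : measurable_fun setT F ->
  (\int[lebesgue_Rn R k]_x F x = \int[mu k]_x F x)%E.
Proof.
move=> mF; rewrite [LHS]integralE [RHS]integralE; congr (_ - _)%E.
  by apply: ge0_integral_lebesgue_Rn => //; exact: measurable_funepos.
by apply: ge0_integral_lebesgue_Rn => //; exact: measurable_funeneg.
Qed.

(** Tonelli's measurability is applied to the positive and negative parts, whose integrals are then
    subtracted. *)
Lemma measurable_integral_section (F : n.-tuple T * m.-tuple T -> R) :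
  measurable_fun setT F ->
  measurable_fun setT (fun x => \int[mu m]_t (F (x, t))%:E)%E.
Proof.
move=> mF; have mFE : measurable_fun setT (EFin \o F) by exact/measurable_EFinP.
rewrite [X in measurable_fun _ X](_ : _ = fubini_F (mu m) (EFin \o F)^\+%E \-
    fubini_F (mu m) (EFin \o F)^\-%E)%E; last first.
  apply/funext => x; rewrite [LHS]integralE /fubini_F; congr (_ - _)%E.
    by apply: eq_integral => t _; rewrite !funeposE.
  by apply: eq_integral => t _; rewrite !funenegE.
apply: emeasurable_funB.
  apply: measurable_fun_fubini_tonelli_F; first exact: measurable_funepos.
  by move=> z; exact: funepos_ge0.
apply: measurable_fun_fubini_tonelli_F; first exact: measurable_funeneg.
by move=> z; exact: funeneg_ge0.
Qed.

Variables (omega : Rn R m -> R) (Nw : set (m.-tuple T)) (w : m.-tuple T -> R).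
Hypotheses (mNw : measurable Nw) (Nw0 : mu m Nw = 0%E).
Hypotheses (mw : measurable_fun setT w) (w_ge0 : forall t, 0 <= w t).
Hypothesis w_supp : forall t, w t != 0 -> open_cube (t : Rn R m).
Hypothesis wE : forall t, ~ Nw t -> open_cube (t : Rn R m) -> omega t = w t.

Lemma w_supp_gt0 t : w t != 0 -> forall i, 0 < tnth t i.
Proof. by move=> /w_supp + i => /(_ i)/andP[]. Qed.

Variables (f : 'I_m -> Rn R n -> R[i]).
Variables (N : 'I_m -> set (n.-tuple T)) (g : 'I_m -> n.-tuple T -> R[i]).
Hypothesis N0 : forall i, measurable (N i) /\ mu n (N i) = 0%E.
Hypothesis mg : forall i, cmeasurable setT (g i).
Hypothesis fg : forall i x, ~ N i x -> f i x = g i x.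

(** Taken jointly in x and t so that Tonelli applies; the cube is encoded in the support of [w]. *)
Definition borel_integrand (z : n.-tuple T * m.-tuple T) : R[i] :=
  (\prod_(i < m) g i (tdilate (tnth z.2 i) z.1)) * (w z.2)%:C%C.

Definition hardy_majorant (x : n.-tuple T) : \bar R :=
  (\int[mu m]_t (hardy_kernel (fun i => normc \o g i) w (x, t))%:E)%E.

Lemma normc_borel_integrand z :
  normc (borel_integrand z) = hardy_kernel (fun i => normc \o g i) w z.
Proof. by rewrite /borel_integrand Normc.normcM normc_prod normc_real. Qed.

Lemma cmeasurable_borel_integrand : cmeasurable setT borel_integrand.
Proof.
have [mRe mIm] : cmeasurable setT
    (fun z => \prod_(i < m) g i (tdilate (tnth z.2 i) z.1)).
  apply: (@cmeasurable_prod _ _ R _ _ (fun i z => g i (tdilate (tnth z.2 i) z.1))).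
  move=> i; have [mRe mIm] := mg i.
  by split; [exact: (measurableT_comp mRe (measurable_tdilate_tnth i))|
             exact: (measurableT_comp mIm (measurable_tdilate_tnth i))].
have mw2 : measurable_fun [set: n.-tuple T * m.-tuple T] (fun z => w z.2).
  exact: (measurableT_comp mw measurable_snd).
split.
- rewrite [X in measurable_fun _ X](_ : _ = (fun z =>
    complex.Re (\prod_(i < m) g i (tdilate (tnth z.2 i) z.1)) * w z.2)).
    exact: measurable_funM.
  apply/funext => z; rewrite /borel_integrand; case: (\prod_(i < m) _) => u v /=.
  by rewrite mulr0 subr0.
- rewrite [X in measurable_fun _ X](_ : _ = (fun z =>
    complex.Im (\prod_(i < m) g i (tdilate (tnth z.2 i) z.1)) * w z.2)).
    exact: measurable_funM.
  apply/funext => z; rewrite /borel_integrand; case: (\prod_(i < m) _) => u v /=.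
  by rewrite mulr0 add0r.
Qed.

Lemma measurable_hardy_majorant : measurable_fun setT hardy_majorant.
Proof.
apply: measurable_integral_section; apply: measurable_hardy_kernel => // i.
exact: measurable_normc.
Qed.

Lemma hardy_majorant_ge0 x : (0 <= hardy_majorant x)%E.
Proof.
apply: integral_ge0 => t _; rewrite lee_fin; apply: hardy_kernel_ge0 => //.
by move=> i y; exact: normc_ge0.
Qed.

(** By [null_dilations], for almost every x the points t_i x avoid the exceptional sets for almost
    all t in the cube; off the cube both sides are 0. *)
Lemma hardy_integrand_mod_null : exists Z, [/\ measurable Z, mu n Z = 0%E &
  forall x, ~ Z x -> exists M, [/\ measurable M, mu m M = 0%E &
    forall t, ~ M t ->
      (if t \in open_cube then hardy_integrand omega f x t else 0) =
      borel_integrand (x, t)]].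
Proof.
have [Z [mZ Z0 ZP]] := @null_dilations R n m N N0.
exists Z; split => // x /ZP[M [mM M0 MP]].
exists (M `|` Nw); split; [exact: measurableU|by rewrite measureU0|].
move=> t /not_orP[Mt Nt]; rewrite /borel_integrand/=.
case: ifPn => [/set_mem tc|tc].
  rewrite /hardy_integrand wE//; congr (_ * _).
  by apply: eq_bigr => i _; rewrite fg//; apply: MP => // j; have /andP[] := tc j.
have -> : w t = 0.
  by apply/eqP; apply: contraNT tc => /w_supp tc; apply/mem_set.
by rewrite (_ : 0%:C%C = 0)// mulr0.
Qed.

(** The three clauses serve the existence of the operator, its measurability and its norm estimate.
    The second holds even where the integral diverges: both sides are then [fine] of the same
    values. *)
Lemma hardy_mod_null : exists Z, [/\ measurable Z, mu n Z = 0%E &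
  forall x, ~ Z x ->
    [/\ (hardy_majorant x < +oo)%E -> hardy_defined omega f x,
        hardy omega f x = Complex
          (fine (\int[mu m]_t (complex.Re (borel_integrand (x, t)))%:E)%E)
          (fine (\int[mu m]_t (complex.Im (borel_integrand (x, t)))%:E)%E) &
        ((normc (hardy omega f x))%:E <= hardy_majorant x)%E]].
Proof.
have [Z [mZ Z0 ZP]] := hardy_integrand_mod_null.
have [mRe mIm] := cmeasurable_borel_integrand.
have mcube : measurable (open_cube : set (Rn R m)).
  exact: measurable_Rn (@measurable_open_cube R m).
exists Z; split => // x /ZP[M [mM M0 MP]].
have mx (F : n.-tuple T * m.-tuple T -> R) : measurable_fun setT F ->
    measurable_fun setT (fun t => (F (x, t))%:E).
  by move=> mF; apply/measurable_EFinP; exact: (measurableT_comp mF (measurable_pair1 x)).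
have mn : measurable_fun setT (fun z => normc (borel_integrand z)).
  exact: (measurable_normc (f := borel_integrand)).
(* [h] will be the real part, the imaginary part or the modulus; all vanish at 0, hence commute with
   extension by 0 off the cube. *)
pose H (h : R[i] -> R) t := ((fun t => (h (hardy_integrand omega f x t))%:E) \_ open_cube) t.
have HP (h : R[i] -> R) : h 0 = 0 -> forall t, ~ M t -> H h t = (h (borel_integrand (x, t)))%:E.
  by move=> h0 t Mt; rewrite /H patchE -MP//; case: ifP => //; rewrite h0.
have intH (h : R[i] -> R) : h 0 = 0 -> measurable_fun setT (fun z => h (borel_integrand z)) ->
    (\int[lebesgue_Rn R m]_(t in open_cube) (h (hardy_integrand omega f x t))%:E =
     \int[mu m]_t (h (borel_integrand (x, t)))%:E)%E.
  move=> h0 mh; rewrite integral_mkcond.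
  rewrite (@integral_Rn_mod_null _ _ M setT mM M0 measurableT (H h) _ (mx _ mh))//.
    exact: integral_lebesgue_Rn (mx _ mh).
  exact: HP.
have majE : (hardy_majorant x = \int[mu m]_t (normc (borel_integrand (x, t)))%:E)%E.
  by apply: eq_integral => t _; rewrite normc_borel_integrand.
have hdef : (hardy_majorant x < +oo)%E -> hardy_defined omega f x.
  rewrite majE => fin.
  suff iH (h : R[i] -> R) : h 0 = 0 -> measurable_fun setT (fun z => h (borel_integrand z)) ->
      (forall z, `|h z| <= normc z) ->
      (lebesgue_Rn R m).-integrable open_cube (fun t => (h (hardy_integrand omega f x t))%:E).
    by split; apply: iH => //; [exact: normr_Re_le|exact: normr_Im_le].
  move=> h0 mh hn; apply/(integrable_mkcond _ mcube)/integrableP.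
  have mHh : measurable_fun [set: Rn R m] (H h).
    exact: measurable_fun_Rn_mod_null mM M0 (mx _ mh) (HP _ h0).
  split => //; apply: le_lt_trans fin.
  rewrite (@ge0_integral_Rn_mod_null _ _ M setT mM M0 measurableT (abse \o H h)
     (fun t => `|(h (borel_integrand (x, t)))%:E|%E))//.
  - apply: ge0_le_integral => //.
    + exact: (measurableT_comp _ (mx _ mh)).
    + exact: (mx (fun z => normc (borel_integrand z)) mn).
    + by move=> t _; rewrite lee_fin.
  - exact: (measurableT_comp _ (mx _ mh)).
  - by move=> t Mt /=; rewrite HP.
split => //.
- by rewrite /hardy /cintegral /Rintegral !intH.
- have [->|fin] := eqVneq (hardy_majorant x) +oo%E; first by rewrite leey.
  apply: (le_trans (normc_cintegral_le mcube (hdef _))); first by rewrite ltey.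
  by rewrite majE intH// Normc.normc0.
Qed.

Lemma cmeasurable_hardy : cmeasurable setT (hardy omega f).
Proof.
have [Z [mZ Z0 ZP]] := hardy_mod_null.
have [mRe mIm] := cmeasurable_borel_integrand.
split.
- apply: (@measurable_fun_Rn_mod_null _ _ _ _ Z _ (fun x =>
    fine (\int[mu m]_t (complex.Re (borel_integrand (x, t)))%:E)%E)) => //.
    exact: (measurableT_comp (fine_measurable measurableT) 
      (measurable_integral_section mRe)).
  by move=> x /ZP[_ -> _].
- apply: (@measurable_fun_Rn_mod_null _ _ _ _ Z _ (fun x =>
    fine (\int[mu m]_t (complex.Im (borel_integrand (x, t)))%:E)%E)) => //.
    exact: (measurableT_comp (fine_measurable measurableT) 
      (measurable_integral_section mIm)).
  by move=> x /ZP[_ -> _].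
Qed.

End hardy_modification.

(** * Central Morrey norms *)

Section morrey.
Context {R : realType} {n : nat}.
Local Open Scope classical_set_scope.
Local Notation T := (measurableTypeR R).
Local Notation mu := (product_lebesgue R n).
Local Notation normc := (@Normc.normc R).
Local Notation vol := (@ball_volume R n).
Implicit Types (f : Rn R n -> R[i]) (q lam M : R).

Lemma normalized_power_le (V e q M : R) (P : \bar R) :
  0 < V -> 0 < q -> 0 <= M -> (0 <= P)%E ->
  ((((V%:E `^ e)^-1 * P) `^ q^-1 <= M%:E) = (P <= (V `^ e * M `^ q)%:E))%E.
Proof.
move=> V0 q0 M0 P0; have Ve0 : 0 < V `^ e by exact: powR_gt0.
rewrite poweR_EFin inver gt_eqF//.
have KP0 : (0 <= (V `^ e)^-1%:E * P)%E by rewrite mule_ge0// lee_fin invr_ge0 ltW.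
rewrite EFinM -lee_pdivrMl//.
apply/idP/idP => H.
  have := gt0_ler_poweR (ltW q0) _ _ H.
  rewrite !in_itv/= !leey !andbT poweR_ge0 lee_fin M0 => /(_ erefl erefl).
  by rewrite -poweRrM mulVf ?gt_eqF// poweRe1.
have qi0 : 0 <= q^-1 by rewrite invr_ge0 ltW.
have := gt0_ler_poweR qi0 _ _ H.
rewrite !in_itv/= !leey !andbT lee_fin powR_ge0 KP0 => /(_ erefl erefl).
by rewrite /= -powRrM divff ?gt_eqF// powRr1.
Qed.

Lemma lebesgue_Rn_eball r : 0 < r -> lebesgue_Rn R n (eball origin r) = (vol r)%:E.
Proof.
move=> r0; rewrite eball_origin lebesgue_RnE; last exact: measurable_tball.
exact: product_lebesgue_tball.
Qed.

Lemma pth_integral_ge0 q f B : (0 <= pth_integral q f B)%E.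
Proof. by apply: integral_ge0 => x _; rewrite lee_fin powR_ge0. Qed.

(** The form in which norms are used from here on: a family of integral bounds over balls, free of
    roots and quotients. *)
Lemma morrey_norm_leP q lam f M : 0 < q -> 0 <= M ->
  (morrey_norm q lam f <= M%:E)%E <->
  (forall r, 0 < r -> (pth_integral q f (eball origin r) <=
     (vol r `^ (1 + lam * q) * M `^ q)%:E)%E).
Proof.
move=> q0 M0; split => [H r r0|H].
  rewrite -normalized_power_le ?ball_volume_gt0 ?pth_integral_ge0//.
  apply: le_trans H; apply: ereal_sup_ubound; exists r => //.
  by rewrite lebesgue_Rn_eball.
apply: ge_ereal_sup => _ [r /= r0 <-]; rewrite lebesgue_Rn_eball//.
by rewrite normalized_power_le ?ball_volume_gt0 ?pth_integral_ge0// H.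
Qed.

Lemma morrey_norm_ge0 q lam f : (0 <= morrey_norm q lam f)%E.
Proof.
apply: le_trans (ereal_sup_ubound (ex_intro2 _ _ (1 : R) ltr01 erefl)).
exact: poweR_ge0.
Qed.

Lemma pth_integral_borel q f N (g : n.-tuple T -> R[i]) r :
  measurable N -> mu N = 0%E -> cmeasurable setT g -> (forall x, ~ N x -> f x = g x) ->
  pth_integral q f (eball origin r) = (\int[mu]_(x in tball r) (normc (g x) `^ q)%:E)%E.
Proof.
move=> mN N0 mg fg; rewrite /pth_integral eball_origin.
apply: (ge0_integral_Rn_mod_null mN N0 (measurable_tball r)).
- apply/measurable_EFinP; apply: (measurableT_comp (measurable_powR _)).
  exact: measurable_normc.
- by move=> x Nx; rewrite fg.
- by move=> x; rewrite lee_fin powR_ge0.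
Qed.

Lemma measurable_eball (x : Rn R n) r : measurable (eball x r).
Proof.
apply: measurable_Rn.
have m1 : measurable_fun setT
    (fun y : n.-tuple T => Num.sqrt (\sum_(i < n) (tnth y i - coord x i) ^+ 2)).
  apply: (measurableT_comp (f := @Num.sqrt R)).
    by apply: continuous_measurable_fun; exact: sqrt_continuous.
  apply: measurable_sum => i; apply: measurable_funX.
  by apply: measurable_funB; [exact: measurable_tnth|exact: measurable_cst].
have := m1 measurableT `]-oo, r[ (measurable_itv _); rewrite setTI.
congr measurable; apply/seteqP; split => y; rewrite /= in_itv//.
Qed.

Lemma eball_sub_origin (x : Rn R n) : exists2 r : R, 0 < r & eball x 1 `<=` eball origin r.
Proof.
have S0 : 0 <= \sum_(i < n) coord x i ^+ 2 by apply: sumr_ge0 => i _; exact: sqr_ge0.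
(* The radius comes from |y|^2 <= 2 |y - x|^2 + 2 |x|^2, where |y - x| < 1. *)
have r0 : 0 < 2 + 2 * \sum_(i < n) coord x i ^+ 2 by rewrite ltr_wpDr// mulr_ge0.
exists (Num.sqrt (2 + 2 * \sum_(i < n) coord x i ^+ 2)); first by rewrite sqrtr_gt0.
move=> y; rewrite eball_origin /eball /tball /enorm/= => y1.
rewrite ltr_sqrt//.
have {}y1 : \sum_(i < n) (coord y i - coord x i) ^+ 2 < 1.
  by move: y1; rewrite -{1}sqrtr1 ltr_sqrt.
apply: (@le_lt_trans _ _ (2 * (\sum_(i < n) (coord y i - coord x i) ^+ 2) +
    2 * \sum_(i < n) coord x i ^+ 2)); last by rewrite ltrD2r -[ltRHS]mulr1 ltr_pM2l.
rewrite !mulr_sumr -big_split/=; apply: ler_sum => i _.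
rewrite -[tnth y i]/(coord y i) -subr_ge0.
rewrite [X in 0 <= X](_ : _ = (coord y i - 2 * coord x i) ^+ 2) ?sqr_ge0//; ring.
Qed.

(** Local integrability comes for free from a finite norm, since a unit ball around any point lies
    in a centered ball. *)
Lemma in_morreyP q lam f : cmeasurable setT f -> 0 < q ->
  (morrey_norm q lam f < +oo)%E -> in_morrey q lam f.
Proof.
move=> mf q0 fin; split => //; split => // x; exists 1 => //.
have [r r0 xr] := eball_sub_origin x.
apply: (@le_lt_trans _ _ (pth_integral q f (eball origin r))).
  apply: (@ge0_subset_integral _ _ _ (lebesgue_Rn R n) _ _ (measurable_eball x 1)
    (measurable_eball origin r) _ _ _ xr).
    apply: measurable_funTS; apply/measurable_EFinP.
    apply: (measurableT_comp (measurable_powR _)); exact: measurable_normc.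
  by move=> y _; rewrite lee_fin powR_ge0.
have nfin : morrey_norm q lam f \is a fin_num by rewrite ge0_fin_numE// morrey_norm_ge0.
have M0 : 0 <= fine (morrey_norm q lam f) by rewrite fine_ge0// morrey_norm_ge0.
have [+ _] := @morrey_norm_leP q lam f _ q0 M0.
rewrite fineK// => /(_ (lexx _) r r0) H.
by apply: le_lt_trans H _; rewrite ltey.
Qed.

End morrey.

(** * Removing a perturbation of the norms *)

Section limit.
Local Open Scope classical_set_scope.

(** [hardy_bound_borel] wants positive norm bounds, whereas a Morrey norm may vanish; the norms are
    therefore enlarged by e, and e tends to 0. *)
Lemma prod_addr_le_lim (R : realType) (m : nat) (c : 'I_m -> R) (A : R) (X : \bar R) :
  (forall e, 0 < e -> (X <= (A * \prod_(i < m) (c i + e))%:E)%E) ->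
  (X <= (A * \prod_(i < m) c i)%:E)%E.
Proof.
move=> H; apply/lee_addgt0Pr => e e0.
have cv (s : seq 'I_m) : \prod_(i <- s) (c i + x) @[x --> (0 : R)^'+] --> \prod_(i <- s) c i.
  elim: s => [|i s IH].
    rewrite big_nil; under eq_fun do rewrite big_nil; exact: cvg_cst.
  rewrite big_cons; under eq_fun do rewrite big_cons.
  apply: cvgM => //; rewrite -[X in _ --> X]addr0; apply: cvgD; first exact: cvg_cst.
  by apply: cvg_at_right_filter; exact: cvg_id.
have cvA : A * \prod_(i < m) (c i + x) @[x --> (0 : R)^'+] --> A * \prod_(i < m) c i.
  by apply: cvgM; [exact: cvg_cst|exact: cv].
have lt1 : A * \prod_(i < m) c i < A * \prod_(i < m) c i + e by rewrite ltrDl.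
have near1 := cvgr_lt _ cvA _ lt1.
have [x [x0 xe]] : exists x : R, 0 < x /\ A * \prod_(i < m) (c i + x) < A * \prod_(i < m) c i + e.
  near (0 : R)^'+ => x; exists x; split; near: x; [exact: nbhs_right_gt|exact: near1].
by apply: le_trans (H x x0) _; rewrite -EFinD lee_fin ltW.
Unshelve. all: by end_near.
Qed.

End limit.

(** * The upper bound for the operator *)

Section hardy_bounded.
Context {R : realType} {n m : nat}.
Local Open Scope classical_set_scope.
Local Notation T := (measurableTypeR R).
Local Notation mu := (product_lebesgue R).
Local Notation normc := (@Normc.normc R).
Local Notation vol := (@ball_volume R n).
Variables (omega : Rn R m -> R) (p : R) (ps lams : 'I_m -> R).
Hypothesis omega_ge0 : forall t, closed_cube t -> 0 <= omega t.
Hypothesis omega_int :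
  (lebesgue_Rn R m).-integrable closed_cube (fun t => (omega t)%:E).

Lemma hardy_constantE (N : set (m.-tuple T)) (w : m.-tuple T -> R) :
  measurable N -> mu m N = 0%E -> measurable_fun setT w -> (forall t, 0 <= w t) ->
  (forall t, w t != 0 -> open_cube (t : Rn R m)) ->
  (forall t, ~ N t -> open_cube (t : Rn R m) -> omega t = w t) ->
  hardy_constant n omega lams = (\int[mu m]_t (@hardy_weight R n m w lams t)%:E)%E.
Proof.
move=> mN N0 mw w0 wsupp wE; rewrite /hardy_constant integral_mkcond.
apply: (ge0_integral_Rn_mod_null mN N0 measurableT).
- by apply/measurable_EFinP; exact: measurable_hardy_weight.
- move=> t Nt; rewrite patchE; case: ifPn => [/set_mem tc|tc]; first by rewrite wE.
  rewrite /hardy_weight (_ : w t = 0) ?mulr0//.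
  by apply/eqP; apply: contraNT tc => /wsupp ?; apply/mem_set.
- by move=> t; rewrite lee_fin; exact: hardy_weight_ge0.
Qed.

Lemma hardy_constant_ge0 : (0 <= hardy_constant n omega lams)%E.
Proof.
apply: integral_ge0 => t tc; rewrite lee_fin mulr_ge0//.
  by apply: prodr_ge0 => i _; exact: powR_ge0.
by apply: omega_ge0; exact: open_closed_cube.
Qed.

Hypotheses (p_gt1 : 1 < p) (ps_gt0 : forall i, 0 < ps i).
Hypothesis p_def : p^-1 = \sum_(i < m) (ps i)^-1.

(** An integrable function is finite almost everywhere; countably many balls exhaust the space. *)
Lemma powR_integrable_lty_ae (h : n.-tuple T -> \bar R) :
  measurable_fun setT h -> (forall x, 0 <= h x)%E ->
  (forall r, 0 < r -> (\int[mu n]_(x in tball r) (h x `^ p) < +oo)%E) ->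
  exists E, [/\ measurable E, mu n E = 0%E & forall x, ~ E x -> (h x < +oo)%E].
Proof.
move=> mh h0 hfin; pose E := [set x | h x = +oo%E].
have mE : measurable E.
  rewrite (_ : E = h @^-1` [set +oo%E])//.
  by rewrite -[X in measurable X]setTI; exact: mh.
exists E; split => //; last by move=> x /eqP; rewrite ltey.
apply/negligibleP => //.
apply: (@negligibleS _ _ _ _ (\bigcup_k (E `&` tball k.+1%:R))).
  move=> x Ex; exists (Num.trunc (enorm x)) => //; split => //.
  by rewrite /tball/=; have /andP[] := truncn_itv (enorm_ge0 x).
apply: negligible_bigcup => k.
have mhp : measurable_fun (tball k.+1%:R) (fun x => h x `^ p)%E.
  by apply: measurable_funTS; exact: (measurableT_comp (measurable_poweR _) mh).
have ih : (mu n).-integrable (tball k.+1%:R) (fun x => h x `^ p)%E.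
  apply/integrableP; split => //.
  under eq_integral do rewrite gee0_abs ?poweR_ge0//.
  exact: hfin.
have := integrable_ae (measurable_tball _) ih.
apply: negligibleS => x [Ex xk] /= /(_ xk).
by rewrite Ex poweRyr// gt_eqF// (lt_trans ltr01).
Qed.

Lemma hardy_bound_constant : (hardy_constant n omega lams < +oo)%E ->
  hardy_bound n omega ps lams p (\sum_(i < m) lams i)
    (fine (hardy_constant n omega lams)).
Proof.
move=> Afin; have p0 : 0 < p by exact: lt_trans p_gt1.
have [Nw [w [mNw Nw0 mw [w0 wsupp] wE]]] := weight_modification omega_ge0 omega_int.
have AE := hardy_constantE mNw Nw0 mw w0 wsupp wE.
have Afin_num : hardy_constant n omega lams \is a fin_num.
  by rewrite ge0_fin_numE// hardy_constant_ge0.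
set A := fine _; have A0 : 0 <= A by rewrite fine_ge0// hardy_constant_ge0.
have AfE : hardy_constant n omega lams = A%:E by rewrite fineK.
split; [exact: A0|move=> f fM].
have /choice[Ng NgP] : forall i, exists Ng : set (n.-tuple T) * (n.-tuple T -> R[i]),
    [/\ measurable Ng.1, mu n Ng.1 = 0%E, cmeasurable setT Ng.2 &
        forall x, ~ Ng.1 x -> f i x = Ng.2 x].
  move=> i; have [[mf _] _] := fM i.
  by have [N [g [mN N0 mg fg]]] := borel_modification mf; exists (N, g).
pose N i := (Ng i).1; pose g i := (Ng i).2.
have N0 i : measurable (N i) /\ mu n (N i) = 0%E by have [] := NgP i.
have mg i : cmeasurable setT (g i) by have [] := NgP i.
have fg i x : ~ N i x -> f i x = g i x by have [_ _ _] := NgP i; apply.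
have c_fin i : morrey_norm (ps i) (lams i) (f i) \is a fin_num.
  by rewrite ge0_fin_numE ?morrey_norm_ge0//; have [] := fM i.
pose c i := fine (morrey_norm (ps i) (lams i) (f i)).
have c0 i : 0 <= c i by rewrite fine_ge0// morrey_norm_ge0.
pose h := hardy_majorant w g.
have mh : measurable_fun setT h by exact: measurable_hardy_majorant.
have h0 x : (0 <= h x)%E by exact: hardy_majorant_ge0.
(* The Borel estimate, with each norm [c i] enlarged to the positive number c_i + e. *)
have hB e r : 0 < e -> 0 < r -> (\int[mu n]_(x in tball r) (h x `^ p) <=
    (vol r `^ (1 + (\sum_i lams i) * p) * (A * \prod_i (c i + e)) `^ p)%:E)%E.
  move=> e0 r0; have ce0 i : 0 < c i + e by rewrite ltr_wpDl.
  have rhsE : (vol r `^ (\sum_i lams i + p^-1) * \prod_i (c i + e)) `^ p * A `^ p =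
      vol r `^ (1 + (\sum_i lams i) * p) * (A * \prod_i (c i + e)) `^ p.
    have P0 : 0 <= \prod_i (c i + e) by apply: prodr_ge0 => i _; exact: ltW.
    rewrite powRM ?powR_ge0// -powRrM mulrDl mulVf ?gt_eqF// (addrC _ 1).
    by rewrite [in RHS]powRM// -!mulrA; congr (_ * _); rewrite mulrC.
  have bound : (\int[mu n]_(x in tball r) (h x `^ p) <=
      ((vol r `^ (\sum_i lams i + p^-1) * \prod_i (c i + e)) `^ p)%:E *
      (\int[mu m]_t (@hardy_weight R n m w lams t)%:E) `^ p)%E; last first.
    by apply: (le_trans bound); rewrite -AE AfE -rhsE.
  apply: (@hardy_bound_borel R n m (fun i => normc \o g i) w p ps lams (fun i => c i + e)
    p_gt1 ps_gt0 p_def _ _ mw w0 (w_supp_gt0 wsupp) ce0 _ r r0).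
  - by move=> i; exact: measurable_normc.
  - by move=> i x; exact: normc_ge0.
  - move=> i s s0; rewrite -(pth_integral_borel _ _ (N0 i).1 (N0 i).2 (mg i) (fg i)).
    have [+ _] := @morrey_norm_leP R n (ps i) (lams i) (f i) (c i + e) (ps_gt0 i) (ltW (ce0 i)).
    by apply => //; rewrite -[X in (X <= _)%E]fineK// lee_fin lerDl ltW.
have [Z [mZ Z0 ZP]] := hardy_mod_null mNw Nw0 mw w0 wsupp wE N0 mg fg.
have mH := cmeasurable_hardy mNw Nw0 mw w0 wsupp wE N0 mg fg.
(* Finiteness of the majorant almost everywhere is what makes the operator defined almost
   everywhere. *)
have [E [mE E0 EP]] : exists E, [/\ measurable E, mu n E = 0%E & forall x, ~ E x -> (h x < +oo)%E].
  apply: powR_integrable_lty_ae => // r r0.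
  by apply: le_lt_trans (hB 1 r ltr01 r0) _; rewrite ltey.
have pthH r : 0 < r -> (pth_integral p (hardy omega f) (eball origin r) <=
    \int[mu n]_(x in tball r) (h x `^ p))%E.
  move=> r0; rewrite /pth_integral eball_origin.
  have mhp : measurable_fun setT (fun x => h x `^ p)%E.
    exact: (measurableT_comp (measurable_poweR _) mh).
  rewrite -(ge0_integral_lebesgue_Rn (measurable_tball r)); last 2 first.
  - exact: measurable_funTS.
  - by move=> x _; exact: poweR_ge0.
  apply: ae_ge0_le_integral.
  - exact: measurable_Rn (measurable_tball r).
  - by move=> x _; rewrite lee_fin powR_ge0.
  - apply: measurable_funTS; apply/measurable_EFinP.
    apply: (measurableT_comp (measurable_powR _)).
    exact: measurable_normc.
  - by move=> x _; exact: poweR_ge0.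
  - by apply: measurable_funTS; exact: measurable_funT_Rn.
  - have := negligible_Rn mZ Z0; apply: negligibleS => x /= nx.
    apply: contrapT => Zx; apply: nx => _; have [_ _ hx] := ZP x Zx.
    rewrite -poweR_EFin; apply: (gt0_ler_poweR (ltW p0) _ _ hx).
      by rewrite in_itv/= leey andbT lee_fin; exact: sqrtr_ge0.
    by rewrite in_itv/= leey h0.
have normH : (morrey_norm p (\sum_(i < m) lams i) (hardy omega f) <= (A * \prod_i c i)%:E)%E.
  apply: prod_addr_le_lim => e e0.
  have ce0 : 0 <= A * \prod_(i < m) (c i + e).
    by rewrite mulr_ge0// prodr_ge0// => i _; rewrite addr_ge0// ltW.
  have [_] := @morrey_norm_leP R n p (\sum_(i < m) lams i) (hardy omega f) _ p0 ce0; apply.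
  by move=> r r0; apply: le_trans (pthH r r0) (hB e r e0 r0).
split.
- have := negligible_Rn (measurableU _ _ mZ mE) _; rewrite measureU0// => /(_ Z0).
  apply: negligibleS => x /= nx; apply: contrapT => /not_orP[Zx Ex]; apply: nx.
  by have [+ _ _] := ZP x Zx; apply; exact: EP.
- apply: in_morreyP => //; by apply: le_lt_trans normH _; rewrite ltey.
- apply: (le_trans normH); rewrite EFinM -prodEFin.
  by under eq_bigr do rewrite /c fineK//.
Qed.

End hardy_bounded.

(** * Morrey averages of a power of the norm on shells *)

Section shells.
Context {R : realType} {n : nat}.
Local Open Scope classical_set_scope.
Local Notation T := (measurableTypeR R).
Local Notation mu := (product_lebesgue R n).
Local Notation vol := (@ball_volume R n).
Variable th : R.
Hypothesis th01 : 0 < th <= 1.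

Lemma th_ge0 : 0 <= th. Proof. by case/andP: th01 => /ltW. Qed.

Definition shell (a b : R) : set (n.-tuple T) := [set x | a <= enorm x < b].

(** With theta = - lambda_i p_i, this is both the p_i-th power of |x|^(n lambda_i) and the p-th
    power of |x|^(n lambda). *)
Definition shell_power (x : n.-tuple T) : R := enorm x `^ (- (n%:R * th)).

(** The exponent 1 - theta is 1 + lambda_i p_i, so this is a Morrey bound, already raised to the
    power p_i, for |x|^(n lambda_i) cut off to the shell. *)
Definition shell_bound (a b K : R) : Prop := forall r, 0 < r ->
  (\int[mu]_(x in tball r `&` shell a b) (shell_power x)%:E <=
   (vol r `^ (1 - th) * K)%:E)%E.

Lemma measurable_shell a b : measurable (shell a b).
Proof.
rewrite (_ : shell a b = (@enorm R n) @^-1` `[a, b[).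
  by rewrite -[X in measurable X]setTI; exact: measurable_enorm.
by apply/seteqP; split => x; rewrite /= in_itv.
Qed.

Lemma measurable_ball_shell r a b : measurable (tball r `&` shell a b).
Proof. by apply: measurableI; [exact: measurable_tball|exact: measurable_shell]. Qed.

Lemma measurable_shell_power D : measurable_fun D (EFin \o shell_power).
Proof.
apply: measurable_funTS; apply/measurable_EFinP.
by apply: (measurableT_comp (measurable_powR _)); exact: measurable_enorm.
Qed.

Lemma shell_power_ge0 x : (0 <= (shell_power x)%:E)%E.
Proof. by rewrite lee_fin powR_ge0. Qed.

Lemma shell_dilate s a b : 0 < s ->
  tdilate s @^-1` shell (s * a) (s * b) = shell a b.
Proof.
move=> s0; apply/seteqP; split => x; rewrite /shell/= enorm_dilate ?(ltW s0)//;
  by rewrite ler_pM2l// ltr_pM2l.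
Qed.

(** Scale invariance: under dilation by s both the integral and |B(0, r)|^(1 - theta) gain the
    factor s^(n (1 - theta)). *)
Lemma shell_bound_scale s a b K : 0 < s ->
  shell_bound a b K -> shell_bound (s * a) (s * b) K.
Proof.
move=> s0 H r r0; have rs0 : 0 < r / s by rewrite divr_gt0.
have s_ge0 := ltW s0.
have := @ge0_integral_dilate R n s (tball r `&` shell (s * a) (s * b)) (EFin \o shell_power)
  s0 (measurable_ball_shell _ _ _) (@measurable_shell_power _) (fun x _ => shell_power_ge0 x).
rewrite preimage_setI tball_dilate// shell_dilate//.
have -> : (\int[mu]_(x in tball (r / s) `&` shell a b) (EFin \o shell_power) (tdilate s x) =
    (s `^ (- (n%:R * th)))%:E * \int[mu]_(x in tball (r / s) `&` shell a b) (shell_power x)%:E)%E.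
  rewrite -ge0_integralZl//; last 4 first.
  - exact: measurable_ball_shell.
  - exact: measurable_shell_power.
  - by move=> x _; exact: shell_power_ge0.
  - by rewrite lee_fin powR_ge0.
  apply: eq_integral => x _ /=; rewrite -EFinM /shell_power enorm_dilate//.
  by rewrite powRM// enorm_ge0.
move=> E; have sn0 : 0 < s ^+ n by rewrite exprn_gt0.
have {}E : (\int[mu]_(x in tball r `&` shell (s * a) (s * b)) (shell_power x)%:E =
    (s ^+ n * s `^ (- (n%:R * th)))%:E *
    \int[mu]_(x in tball (r / s) `&` shell a b) (shell_power x)%:E)%E.
  by rewrite EFinM -muleA E muleA -EFinM divff ?gt_eqF// mul1e.
rewrite E; apply: (@le_trans _ _ ((s ^+ n * s `^ (- (n%:R * th)))%:E *
    (vol (r / s) `^ (1 - th) * K)%:E)%E).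
  by rewrite lee_wpmul2l ?H// lee_fin mulr_ge0 ?powR_ge0 ?ltW.
rewrite -EFinM lee_fin mulrA.
have -> : vol r = vol (r / s) * s ^+ n.
  by rewrite -ball_volumeM mulrCA divff ?mulr1// gt_eqF.
rewrite (powRM _ (ltW (ball_volume_gt0 rs0)))// ?(ltW sn0)//.
rewrite (_ : s ^+ n * s `^ _ = (s ^+ n) `^ (1 - th)); first by rewrite [X in X * K]mulrC.
rewrite -powR_mulrn// -powRrM -powRD ?(gt_eqF s0) ?implybT//.
by congr (_ `^ _); ring.
Qed.

Lemma shell_bound_add a b c K K' : a <= b -> b <= c ->
  shell_bound a b K -> shell_bound b c K' -> shell_bound a c (K + K').
Proof.
move=> ab bc H H' r r0.
have -> : tball r `&` shell a c = (tball r `&` shell a b) `|` (tball r `&` shell b c).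
  rewrite -setIUr; congr (_ `&` _); apply/seteqP; split => x; rewrite /shell/=.
    by move=> /andP[ax xc]; case: (ltP (enorm x) b) => xb; [left|right]; apply/andP.
  by move=> [|] /andP[ax xb]; apply/andP; split => //;
    [exact: lt_le_trans bc|exact: le_trans ax].
rewrite ge0_integral_setU//; last 5 first.
- exact: measurable_ball_shell.
- exact: measurable_ball_shell.
- exact: measurable_shell_power.
- by move=> x _; exact: shell_power_ge0.
- apply/disj_setPS => x [[_ /andP[_ xb]] [_ /andP[bx _]]].
  by move: xb; rewrite ltNge bx.
by rewrite mulrDr EFinD leeD ?H ?H'.
Qed.

Lemma shell_bound_unit N : 1 < N -> exists2 K, 0 <= K & shell_bound 1 N K.
Proof.
move=> N1; have N0 : 0 < N by exact: lt_trans N1.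
have V1 := @ball_volume_gt0 R n 1 ltr01.
(* For r <= 1 the domain is empty. For r > 1 the integrand is at most 1 on the shell, and |B(0,
   r)|^(1 - theta) >= |B(0, 1)|^(1 - theta) because theta <= 1. *)
exists (vol N / vol 1 `^ (1 - th)).
  by rewrite divr_ge0 ?powR_ge0// ltW// ball_volume_gt0.
move=> r r0; have [r1|r1] := leP r 1.
  rewrite [X in (\int[mu]_(x in X) _)%E](_ : _ = set0).
    rewrite integral_set0 lee_fin mulr_ge0 ?powR_ge0// divr_ge0 ?powR_ge0//.
    by rewrite ltW// ball_volume_gt0.
  apply/seteqP; split => // x [/= xr /andP[x1 _]].
  by have := lt_le_trans xr (le_trans r1 x1); rewrite ltxx.
apply: (@le_trans _ _ (\int[mu]_(x in tball N) (cst 1%E) x)%E).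
  apply: (@le_trans _ _ (\int[mu]_(x in tball r `&` shell 1 N) (cst 1%E) x)%E).
    apply: ge0_le_integral => //; first exact: measurable_ball_shell.
    - by move=> x _; exact: shell_power_ge0.
    - exact: measurable_shell_power.
    - move=> x [_ /andP[x1 _]]; rewrite lee_fin /shell_power powRN.
      rewrite invf_le1 ?powR_gt0 ?(lt_le_trans ltr01)//.
      by rewrite -[leLHS](powRr0 (enorm x)) ler_powR// mulr_ge0// th_ge0.
  apply: (@ge0_subset_integral _ _ _ mu _ _ (measurable_ball_shell _ _ _)
    (measurable_tball _) (cst 1%E)) => //.
  by move=> x [_ /andP[]].
rewrite integral_cst; last exact: measurable_tball.
rewrite mul1e [leLHS](product_lebesgue_tball N0) lee_fin -/(ball_volume N) mulrCA ler_peMr//.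
  by rewrite ltW// ball_volume_gt0.
rewrite ler_pdivlMr ?powR_gt0// mul1r ge0_ler_powR ?nnegrE//.
- by rewrite subr_ge0; case/andP: th01.
- by rewrite ltW.
- by rewrite ltW// ball_volume_gt0.
- by rewrite /ball_volume ler_pM2l ?vol1_gt0// expr1n exprn_ege1// ltW.
Qed.

(** The large shell is made of k + 1 dilates of [1, N), each with the same bound by scaling; hence
    the growth is only linear in k. *)
Lemma shell_bound_pow N K k : 1 < N -> shell_bound 1 N K ->
  shell_bound 1 (N ^+ k.+1) (k.+1%:R * K).
Proof.
move=> N1 H; have N0 : 0 < N by exact: lt_trans N1.
elim: k => [|k IH]; first by rewrite expr1 mul1r.
rewrite -natr1 mulrDl mul1r; apply: shell_bound_add IH _.
- by rewrite exprn_ege1// ltW.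
- by rewrite [leRHS]exprS ler_peMl ?exprn_ge0// ltW.
rewrite [N ^+ k.+2]exprSr -[X in shell_bound X]mulr1.
by apply: shell_bound_scale => //; rewrite exprn_gt0.
Qed.

(** Test with r = N: the power is at least N^(-n theta) on the shell, whose volume is positive
    because n > 0. *)
Lemma shell_bound_lower N : (0 < n)%N -> 1 < N ->
  exists2 e, 0 < e & forall K, shell_bound 1 N K -> e <= K.
Proof.
move=> n0 N1; have N0 : 0 < N by exact: lt_trans N1.
have VN := @ball_volume_gt0 R n N N0.
have dV : 0 < vol N - vol 1.
  rewrite subr_gt0 /ball_volume ltr_pM2l ?vol1_gt0// expr1n.
  by rewrite exprn_egt1// -lt0n.
exists (N `^ (- (n%:R * th)) * (vol N - vol 1) / vol N `^ (1 - th)).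
  by rewrite divr_gt0 ?mulr_gt0 ?powR_gt0.
move=> K /(_ N N0) H; rewrite ler_pdivrMr ?powR_gt0// [leRHS]mulrC -lee_fin.
apply: le_trans H.
have muS : mu (tball N `&` shell 1 N) = (vol N - vol 1)%:E.
  rewrite (_ : _ `&` _ = tball N `\` tball 1); last first.
    apply/seteqP; split => x [/= xN].
      by move=> /andP[x1 _]; split => //; apply/negP; rewrite -leNgt.
    by move=> /negP; rewrite /tball/= -leNgt => x1; split => //; apply/andP.
  rewrite measureD; [|exact: measurable_tball|exact: measurable_tball|].
    rewrite setIidr; last by move=> x /lt_trans; apply.
    by rewrite [X in (X - _)%E](product_lebesgue_tball N0)
      [X in (_ - X)%E](product_lebesgue_tball ltr01).
  by rewrite [ltLHS](product_lebesgue_tball N0) ltey.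
rewrite EFinM -muS -integral_cst; last exact: measurable_ball_shell.
apply: ge0_le_integral => //; first exact: measurable_ball_shell.
- by move=> x _; rewrite lee_fin powR_ge0.
- exact: measurable_shell_power.
- move=> x [_ /andP[x1 xN]]; rewrite lee_fin /shell_power !powRN.
  have x0 : 0 < enorm x by exact: lt_le_trans x1.
  rewrite lef_pV2 ?posrE ?powR_gt0// ge0_ler_powR ?nnegrE ?(ltW x0) ?(ltW N0) ?(ltW xN)//.
  by rewrite mulr_ge0// th_ge0.
Qed.

End shells.

(** This sets the factor q^k gained in k descents against the linear growth in [shell_bound_pow]. *)
Lemma natM_geometric_lt (R : realType) (q K e : R) : 0 < q < 1 -> 0 < e ->
  exists k, q ^+ k * (k.+1%:R * K) < e.
Proof.
move=> /andP[q0 q1] e0.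
(* Bernoulli for y = q^(-1/2) gives d (k + 1) <= y^k, so that
   (k + 1) q^k <= 1 / (d^2 (k + 1)). *)
pose s := Num.sqrt q; have s0 : 0 < s by rewrite sqrtr_gt0.
have s1 : s < 1 by rewrite -sqrtr1 ltr_sqrt.
pose y := s^-1; have y1 : 1 < y by rewrite /y invf_gt1.
pose d := Num.min 1 (y - 1).
have d0 : 0 < d by rewrite lt_min ltr01 subr_gt0.
have bern k : d * k.+1%:R <= y ^+ k.
  elim: k => [|k IH]; first by rewrite expr0 mulr1 ge_min lexx.
  have yk1 : 1 <= y ^+ k by rewrite exprn_ege1// ltW.
  have -> : y ^+ k.+1 = y ^+ k + (y - 1) * y ^+ k by rewrite exprS; ring.
  rewrite -natr1 mulrDr mulr1 lerD//; apply: (@le_trans _ _ (y - 1)).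
    by rewrite ge_min lexx orbT.
  by rewrite ler_peMr// subr_ge0 ltW.
(* Replaces [K] by a positive upper bound, as nothing is known of its sign. *)
pose M := Num.max K 1; have M0 : 0 < M by rewrite lt_max ltr01 orbT.
have [k kM] : exists k : nat, M / (e * d ^+ 2) < k.+1%:R.
  exists (Num.trunc (M / (e * d ^+ 2))).
  have /truncn_itv/andP[] // : 0 <= M / (e * d ^+ 2).
  by rewrite divr_ge0 ?mulr_ge0 ?sqr_ge0// ltW.
have qk0 : 0 < q ^+ k by rewrite exprn_gt0.
exists k; apply: (@le_lt_trans _ _ (q ^+ k * (k.+1%:R * M))).
  by rewrite !ler_pM2l// le_max lexx.
have qy : q ^+ k * (y ^+ k * y ^+ k) = 1.
  by rewrite -!exprMn -{1}(sqr_sqrtr (ltW q0)) -/s expr2 mulrACA !divff ?gt_eqF// mulr1 expr1n.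
have dk2 : (d * k.+1%:R) ^+ 2 <= y ^+ k * y ^+ k.
  have dk0 : 0 <= d * k.+1%:R by rewrite mulr_ge0// ltW.
  by rewrite expr2 ler_pM.
rewrite -ltr_pdivlMl//.
have -> : (q ^+ k)^-1 = y ^+ k * y ^+ k.
  by apply: (mulfI (lt0r_neq0 qk0)); rewrite qy divff// gt_eqF.
apply: (@lt_le_trans _ _ ((d * k.+1%:R) ^+ 2 * e)); last by rewrite ler_pM2r.
move: kM; rewrite ltr_pdivrMr ?mulr_gt0 ?exprn_gt0// => kM.
rewrite [ltRHS](_ : _ = k.+1%:R * (k.+1%:R * (e * d ^+ 2))); last by ring.
by rewrite ltr_pM2l.
Qed.

(** * The lower bound for the operator *)

Section lower_bound.
Context {R : realType} {n m : nat}.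
Local Open Scope classical_set_scope.
Local Notation T := (measurableTypeR R).
Local Notation mu := (product_lebesgue R).
Local Notation normc := (@Normc.normc R).
Local Notation vol := (@ball_volume R n).
Variables (omega : Rn R m -> R) (p th : R) (ps lams : 'I_m -> R).
Hypothesis omega_ge0 : forall t, closed_cube t -> 0 <= omega t.
Hypothesis omega_int :
  (lebesgue_Rn R m).-integrable closed_cube (fun t => (omega t)%:E).
Hypotheses (n_gt0 : (0 < n)%N) (p_gt0 : 0 < p) (ps_gt0 : forall i, 0 < ps i).
Hypothesis p_def : p^-1 = \sum_(i < m) (ps i)^-1.
Hypotheses (th01 : 0 < th <= 1) (lamE : forall i, lams i * ps i = - th).
Local Notation lam := (\sum_(i < m) lams i).

Lemma lam_divE i : lams i = - th / ps i.
Proof. by rewrite -(lamE i) mulfK// gt_eqF. Qed.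

(** The target space has the same exponent theta as the source spaces, so the estimate of the image
    is again a [shell_bound] and can be iterated. *)
Lemma lam_sumE : lam * p = - th.
Proof.
under eq_bigr do rewrite lam_divE.
by rewrite -mulr_sumr -p_def -mulrA mulVf ?mulr1// gt_eqF.
Qed.

Lemma hardy_bound_le C C' : C <= C' ->
  hardy_bound n omega ps lams p lam C -> hardy_bound n omega ps lams p lam C'.
Proof.
move=> CC' [C0 H]; split => [|f fM]; first exact: le_trans CC'.
have [H1 H2 H3] := H f fM; split => //; apply: (le_trans H3).
by rewrite lee_wpmul2r ?lee_fin// prode_ge0// => i _; exact: morrey_norm_ge0.
Qed.

Definition shell_fun (b : R) (i : 'I_m) (x : n.-tuple T) : R :=
  \1_(shell 1 b) x * enorm x `^ (n%:R * lams i).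

Lemma shell_fun_ge0 b i x : 0 <= shell_fun b i x.
Proof. by rewrite mulr_ge0 ?powR_ge0// indicE. Qed.

(** This dominates the operator's integrand on the test functions by the integrable [w]. *)
Lemma shell_fun_le1 b i x : shell_fun b i x <= 1.
Proof.
rewrite /shell_fun indicE; case: (boolP (x \in _)) => [/set_mem xs|_]; last by rewrite mul0r.
have /andP[x1 _] : 1 <= enorm x < b := xs.
rewrite mul1r -[X in _ <= X](powRr0 (enorm x)) ler_powR//.
rewrite mulr_ge0_le0// lam_divE mulNr oppr_le0 divr_ge0// ltW//.
by case/andP: th01.
Qed.

Lemma measurable_shell_fun b i : measurable_fun setT (shell_fun b i).
Proof.
apply: measurable_funM; first by apply: measurable_indic; exact: measurable_shell.
by apply: (measurableT_comp (measurable_powR _)); exact: measurable_enorm.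
Qed.

Definition shell_cfun b i (x : n.-tuple T) : R[i] := (shell_fun b i x)%:C%C.

Lemma normc_shell_cfun b i x : normc (shell_cfun b i x) = shell_fun b i x.
Proof. exact/normc_real/shell_fun_ge0. Qed.

Lemma cmeasurable_shell_cfun b i : cmeasurable setT (shell_cfun b i).
Proof. by split; [exact: measurable_shell_fun|exact: measurable_cst]. Qed.

Lemma morrey_norm_shell_cfun b i K : 0 < K -> shell_bound (n := n) th 1 b K ->
  (morrey_norm (ps i) (lams i) (shell_cfun b i : Rn R n -> R[i]) <= (K `^ (ps i)^-1)%:E)%E.
Proof.
move=> K0 H; have [_] := @morrey_norm_leP R n (ps i) (lams i) (shell_cfun b i)
  (K `^ (ps i)^-1) (ps_gt0 i) (powR_ge0 _ _).
apply => r r0; rewrite (@pth_integral_borel _ _ _ _ set0 (shell_cfun b i))//; last first.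
  exact: cmeasurable_shell_cfun.
rewrite lamE -powRrM mulVf ?gt_eqF// powRr1 ?(ltW K0)//.
apply: (le_trans _ (H r r0)).
rewrite integral_mkcondr; apply: ge0_le_integral => //.
- exact: measurable_tball.
- by move=> x _; rewrite lee_fin powR_ge0.
- apply: measurable_funTS; apply/measurable_EFinP.
  apply: (measurableT_comp (measurable_powR _)).
  exact: measurable_normc (cmeasurable_shell_cfun b i).
- apply: measurable_funTS; apply/(measurable_restrictT _ (measurable_shell _ _)).
  exact: measurable_shell_power.
- move=> x _; rewrite normc_shell_cfun patchE /shell_fun indicE.
  case: ifPn => _; last by rewrite mul0r powR0 ?gt_eqF.
  by rewrite mul1r -powRrM -mulrA lamE mulrN.
Qed.

Variables (Nw : set (m.-tuple T)) (w : m.-tuple T -> R).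
Hypotheses (mNw : measurable Nw) (Nw0 : mu m Nw = 0%E).
Hypotheses (mw : measurable_fun setT w) (w_ge0 : forall t, 0 <= w t).
Hypothesis w_supp : forall t, w t != 0 -> open_cube (t : Rn R m).
Hypothesis wE : forall t, ~ Nw t -> open_cube (t : Rn R m) -> omega t = w t.

Lemma weight_integral_lty : (\int[mu m]_t (w t)%:E < +oo)%E.
Proof.
have mcube := measurable_Rn (@measurable_open_cube R m).
have /integrableP[_] : (lebesgue_Rn R m).-integrable open_cube (fun t => (omega t)%:E).
  apply: integrableS omega_int => //; last exact: open_closed_cube.
  exact: measurable_Rn (@measurable_closed_cube R m).
apply: le_lt_trans; rewrite [leRHS]integral_mkcond.
rewrite (@ge0_integral_Rn_mod_null _ _ _ setT mNw Nw0 measurableT _ (EFin \o w))//.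
- exact/measurable_EFinP.
- move=> t Nt; rewrite patchE; case: ifPn => [/set_mem tc|tc].
    by rewrite wE// gee0_abs// lee_fin.
  congr (_%:E); apply/esym/eqP; apply: contraNT tc => /w_supp tc; exact/mem_set.
Qed.

(** Only the lower bounds t_i >= 1/N are imposed; the upper bounds come from the support of [w]. *)
Definition truncated_cube (N : R) : set (m.-tuple T) :=
  [set t | forall i, `[N^-1, +oo[%classic (tnth t i)].

Definition truncated_weight N (t : m.-tuple T) : R :=
  @hardy_weight R n m w lams t * \1_(truncated_cube N) t.

Lemma measurable_truncated_weight N : measurable_fun setT (truncated_weight N).
Proof.
apply: measurable_funM; first exact: measurable_hardy_weight.
apply: measurable_indic; exact: (@measurable_rectangle R m (fun=> `[N^-1, +oo[%classic)).
Qed.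

Lemma truncated_weight_ge0 N t : 0 <= truncated_weight N t.
Proof. by rewrite mulr_ge0 ?hardy_weight_ge0// indicE. Qed.

(** If 1/N <= t_i < 1 and N <= |x| < b, then t_i x stays in the shell [1, b), where the cut-off is 1
    and the powers factor. *)
Lemma hardy_kernel_shell_ge b N x t : 0 < N -> shell N b x ->
  enorm x `^ (n%:R * lam) * truncated_weight N t <=
  hardy_kernel (shell_fun b) w (x, t).
Proof.
move=> N0 /andP[Nx xb]; rewrite /truncated_weight /hardy_kernel /hardy_weight/=.
have x0 : 0 < enorm x by exact: lt_le_trans Nx.
have [->|wt0] := eqVneq (w t) 0; first by rewrite !(mulr0, mul0r).
have tc := w_supp wt0.
rewrite indicE; case: (boolP (t \in _)) => [/set_mem tN|_]; last first.
  by rewrite !mulr0 mulr_ge0// prodr_ge0// => i _; exact: shell_fun_ge0.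
rewrite mulr1 mulrA ler_wpM2r// mulr_sumr powR_sum// -big_split/=.
apply: ler_prod => i _; rewrite mulr_ge0 ?powR_ge0//= /shell_fun.
have /andP[ti0 ti1] := tc i; have := tN i; rewrite /= in_itv/= andbT => Nti.
rewrite indicE mem_set/=.
  by rewrite mul1r enorm_dilate ?(ltW ti0)// powRM ?(ltW ti0) ?(ltW x0)// mulrC.
rewrite /shell/= enorm_dilate ?(ltW ti0)//; apply/andP; split.
  by rewrite -(mulVf (lt0r_neq0 N0)) ler_pM// ?invr_ge0 ltW.
by apply: le_lt_trans xb; rewrite ler_piMl ?(ltW x0)// ltW.
Qed.

Lemma normc_hardy_shell_ge b N a : 0 < N ->
  (a%:E <= \int[mu m]_t (truncated_weight N t)%:E)%E ->
  exists Z, [/\ measurable Z, mu n Z = 0%E & forall x, ~ Z x -> shell N b x ->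
    a * enorm x `^ (n%:R * lam) <= normc (hardy omega (shell_cfun b) (x : Rn R n))].
Proof.
move=> N0 aA.
have [Z [mZ Z0 ZP]] := @hardy_mod_null R n m omega Nw w mNw Nw0 mw w_ge0 w_supp wE
  (shell_cfun b) (fun=> set0) (shell_cfun b) (fun=> conj measurable0 (measure0 _))
  (cmeasurable_shell_cfun b) (fun i x _ => erefl).
exists Z; split => // x Zx xs; have [_ -> _] := ZP x Zx.
set h := Complex _ _.
apply: (le_trans _ (le_trans (ler_norm _) (normr_Re_le h))); rewrite /h /=.
have kE t : complex.Re (borel_integrand w (shell_cfun b) (x, t)) =
    hardy_kernel (shell_fun b) w (x, t).
  by rewrite /borel_integrand prod_real_complex -rmorphM.
under eq_integral do rewrite kE.
have k0 t : (0 <= (hardy_kernel (shell_fun b) w (x, t))%:E)%E.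
  by rewrite lee_fin hardy_kernel_ge0// => i y; exact: shell_fun_ge0.
have mk : measurable_fun setT (fun t => (hardy_kernel (shell_fun b) w (x, t))%:E).
  apply/measurable_EFinP.
  apply: (measurableT_comp _ (measurable_pair1 x)).
  by apply: measurable_hardy_kernel => // i; exact: measurable_shell_fun.
(* Finiteness is essential: [fine] sends an infinite integral to 0, which would destroy the lower
   bound. *)
have fin : (\int[mu m]_t (hardy_kernel (shell_fun b) w (x, t))%:E < +oo)%E.
  apply: le_lt_trans weight_integral_lty; apply: ge0_le_integral => //.
    exact/measurable_EFinP.
  move=> t _; rewrite lee_fin /hardy_kernel ler_piMl//.
  apply: (@le_trans _ _ (\prod_(i < m) 1)); last by rewrite big1.
  by apply: ler_prod => i _; rewrite shell_fun_ge0 shell_fun_le1.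
rewrite -lee_fin fineK; last by rewrite ge0_fin_numE// integral_ge0.
have X0 : (0 <= (enorm x `^ (n%:R * lam))%:E)%E by rewrite lee_fin powR_ge0.
rewrite mulrC EFinM; apply: (le_trans (lee_wpmul2l X0 aA)).
rewrite -ge0_integralZl//; last 2 first.
- by apply/measurable_EFinP; exact: measurable_truncated_weight.
- by move=> t _; rewrite lee_fin truncated_weight_ge0.
apply: ge0_le_integral => //.
- by move=> t _; rewrite mule_ge0// lee_fin truncated_weight_ge0.
- apply: emeasurable_funM; first exact: measurable_cst.
  by apply/measurable_EFinP; exact: measurable_truncated_weight.
- by move=> t _; rewrite -EFinM lee_fin; exact: hardy_kernel_shell_ge.
Qed.

(** Apply the operator bound to the test functions on [1, b). Their norms multiply to at most
    K^(1/p), while the image is at least a |x|^(n lambda) on [N, b); rescaling by 1/N brings this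
    shell back to inner radius 1. *)
Lemma shell_bound_step b N C a K : 0 < N -> 0 < a -> 0 < K ->
  hardy_bound n omega ps lams p lam C ->
  (a%:E <= \int[mu m]_t (truncated_weight N t)%:E)%E ->
  shell_bound (n := n) th 1 b K ->
  shell_bound (n := n) th 1 (N^-1 * b) ((C / a) `^ p * K).
Proof.
move=> N0 a0 K0 [C0 HC] aA bK.
pose f i : Rn R n -> R[i] := shell_cfun b i.
have normf i : (morrey_norm (ps i) (lams i) (f i) <= (K `^ (ps i)^-1)%:E)%E.
  exact: morrey_norm_shell_cfun.
have mf i : cmeasurable [set: Rn R n] (f i).
  have [mRe mIm] := cmeasurable_shell_cfun b i.
  by split; exact: measurable_funT_Rn.
have fM i : in_morrey (ps i) (lams i) (f i).
  apply: in_morreyP => //; apply: le_lt_trans (normf i) _; exact: ltey.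
have [_ [[mH _] _] normH] := HC f fM.
have CK0 : 0 <= C * K `^ p^-1 by rewrite mulr_ge0 ?powR_ge0.
have {}normH : (morrey_norm p lam (hardy omega f) <= (C * K `^ p^-1)%:E)%E.
  apply: (le_trans normH); rewrite EFinM lee_wpmul2l ?lee_fin//.
  rewrite p_def powR_sum// -prodEFin.
  apply: (proj2 (_ : _ /\ _)); apply: (big_ind2 (fun x y => 0 <= x /\ x <= y)%E) => //.
    by move=> x x' y y' [x0 xx'] [y0 yy']; rewrite mule_ge0// lee_pmul.
  by move=> i _; rewrite morrey_norm_ge0 normf.
have [Z [mZ Z0 ZP]] := normc_hardy_shell_ge b N0 aA.
have bN : shell_bound (n := n) th N b ((C / a) `^ p * K).
  move=> r r0; have [+ _] := @morrey_norm_leP R n p lam (hardy omega f) _ p_gt0 CK0.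
  move=> /(_ normH r r0) H.
  have ap0 : 0 < a `^ p by exact: powR_gt0.
  rewrite -(@lee_pmul2l _ (a `^ p)%:E) ?lte_fin//.
  apply: (@le_trans _ _ (pth_integral p (hardy omega f) (eball origin r))); last first.
    apply: (le_trans H); rewrite -EFinM lee_fin lam_sumE powRM ?powR_ge0//.
    rewrite -powRrM mulVf ?gt_eqF// powRr1 ?(ltW K0)//.
    rewrite (powRM _ C0) ?invr_ge0 ?(ltW a0)// -(powR_inv1 (ltW a0)) -powRrM mulN1r powRN.
    rewrite [leRHS](_ : _ = vol r `^ (1 - th) * (C `^ p * K))//.
    by field; rewrite gt_eqF.
  rewrite /pth_integral eball_origin -ge0_integralZl//; last 4 first.
  - exact: measurable_ball_shell.
  - exact: measurable_shell_power.
  - by move=> x _; exact: shell_power_ge0.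
  - by rewrite lee_fin powR_ge0.
  have mS := @measurable_ball_shell R n r N b.
  have mg : measurable_fun setT (fun x : n.-tuple T => ((a `^ p)%:E * (shell_power th x)%:E)%E).
    by apply: emeasurable_funM; [exact: measurable_cst|exact: measurable_shell_power].
  have g0 x : (0 <= (a `^ p)%:E * (@shell_power R n th x)%:E)%E.
    by rewrite -EFinM lee_fin mulr_ge0 ?powR_ge0.
  have mHp : measurable_fun [set: Rn R n] (fun x => (normc (hardy omega f x) `^ p)%:E).
    apply/measurable_EFinP; apply: (measurableT_comp (measurable_powR _)).
    exact: measurable_normc mH.
  rewrite -(ge0_integral_lebesgue_Rn mS); last 2 first.
  - exact: measurable_funTS.
  - by move=> x _; exact: g0.
  apply: (@le_trans _ _ (\int[lebesgue_Rn R n]_(x in (tball r `&` shell N b : set (Rn R n)))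
      (normc (hardy omega f x) `^ p)%:E)%E).
    apply: ae_ge0_le_integral.
    - exact: measurable_Rn mS.
    - by move=> x _; exact: g0.
    - by apply: measurable_funTS; exact: measurable_funT_Rn mg.
    - by move=> x _; rewrite lee_fin powR_ge0.
    - exact: measurable_funTS mHp.
    - have := negligible_Rn mZ Z0; apply: negligibleS => x nx.
      apply: contrapT => Zx; apply: nx => -[_ xs].
      have := ZP x Zx xs; move: (normc _) => y ay.
      have y0 : 0 <= y by apply: le_trans ay; rewrite mulr_ge0 ?powR_ge0// ltW.
      rewrite -EFinM lee_fin.
      have -> : shell_power th (x : n.-tuple T) = (enorm x `^ (n%:R * lam)) `^ p.
        by rewrite -powRrM -mulrA lam_sumE mulrN.
      rewrite -powRM ?powR_ge0 ?(ltW a0)//.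
      apply: (ge0_ler_powR (ltW p_gt0)); rewrite ?nnegrE//.
      by rewrite mulr_ge0 ?powR_ge0// ltW.
  apply: (@ge0_subset_integral _ _ _ (lebesgue_Rn R n) _ _ (measurable_Rn mS)
    (measurable_Rn (measurable_tball r))).
  - exact: measurable_funTS mHp.
  - by move=> x _; rewrite lee_fin powR_ge0.
  - by move=> x [].
rewrite -[X in shell_bound _ X](mulVf (lt0r_neq0 N0)).
by apply: shell_bound_scale => //; rewrite invr_gt0.
Qed.

(* If C < a, then each application of shell_bound_step gains a factor
   q = (C / a)^p < 1, whereas the bound on (1, N^(k+1)) grows only linearly in k. *)
Lemma truncated_weight_integral_le N C : 1 < N ->
  hardy_bound n omega ps lams p lam C ->
  (\int[mu m]_t (truncated_weight N t)%:E <= C%:E)%E.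
Proof.
move=> N1 HC; have C0 : 0 <= C by case: HC.
have N0 : 0 < N by exact: lt_trans N1.
rewrite leNgt; apply/negP => CA.
(* A real number above [C] and at most the truncated integral, also if that integral is infinite. *)
have [a [Ca aA]] : exists a, C < a /\ (a%:E <= \int[mu m]_t (truncated_weight N t)%:E)%E.
  move: CA; case: (\int[mu m]_t _)%E => [a| |//] CA; first by exists a.
  by exists (C + 1); rewrite ltrDl leey.
(* [C] may be 0; the midpoint is a positive operator bound still below [a], which gives 0 < q <
   1. *)
pose C' := (C + a) / 2.
have CC' : C <= C' by rewrite /C'; lra.
have C'0 : 0 < C' by rewrite /C'; lra.
have C'a : C' < a by rewrite /C'; lra.
have a0 : 0 < a by exact: lt_trans C'a.
have HC' := hardy_bound_le CC' HC.
pose q := (C' / a) `^ p.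
have q01 : 0 < q < 1.
  have ca0 : 0 < C' / a by rewrite divr_gt0.
  have one_p : 1 `^ p = 1 :> R by rewrite powR1.
  rewrite powR_gt0//= -[ltRHS]one_p gt0_ltr_powR ?nnegrE// ?(ltW ca0)//.
  by rewrite ltr_pdivrMr// mul1r.
have q0 : 0 < q by case/andP: q01.
have [e e0 eP] := @shell_bound_lower R n th th01 N n_gt0 N1.
have [K _ bK] := @shell_bound_unit R n th th01 N N1.
have K0 : 0 < K by exact: lt_le_trans (eP _ bK).
have iter j k L : 0 < L -> shell_bound (n := n) th 1 (N ^+ (j + k)) L ->
    shell_bound (n := n) th 1 (N ^+ k) (q ^+ j * L).
  elim: j L => [|j IH] L L0 bL; first by rewrite expr0 mul1r.
  rewrite exprSr -mulrA; apply: IH; first by rewrite mulr_gt0.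
  have := shell_bound_step N0 a0 L0 HC' aA bL.
  by rewrite addSn exprS mulKf// gt_eqF.
have [k] := natM_geometric_lt K q01 e0; apply/negP; rewrite -leNgt.
(* k descents lead from the shell [1, N^(k+1)) to [1, N), where every bound is at least [e]. *)
apply: eP; rewrite -[N in X in shell_bound _ _ X]expr1; apply: iter.
  by rewrite mulr_gt0.
by rewrite addn1; exact: shell_bound_pow.
Qed.

(** Monotone convergence of the truncated integrals. *)
Lemma hardy_constant_le C : hardy_bound n omega ps lams p lam C ->
  (hardy_constant n omega lams <= C%:E)%E.
Proof.
move=> HC; rewrite (hardy_constantE lams mNw Nw0 mw w_ge0 w_supp wE).
(* The shift by 2 makes N > 1 for every k. *)
pose g k t := (truncated_weight k.+2%:R t)%:E.
have g0 k t : setT t -> (0 <= g k t)%E by move=> _; rewrite lee_fin truncated_weight_ge0.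
have mg k : measurable_fun setT (g k).
  by apply/measurable_EFinP; exact: measurable_truncated_weight.
have sub_cube k l : (k <= l)%N ->
    truncated_cube k.+2%:R `<=` truncated_cube l.+2%:R.
  move=> kl t tk i; have := tk i; rewrite /= !in_itv/= !andbT; apply: le_trans.
  by rewrite lef_pV2 ?posrE// ler_nat.
have ndg t : setT t -> {homo g^~ t : k l / (k <= l)%N >-> (k <= l)%E}.
  move=> _ k l kl; rewrite lee_fin ler_wpM2l ?hardy_weight_ge0// !indicE ler_nat.
  case: (boolP (t \in truncated_cube k.+2%:R)) => // /set_mem /(sub_cube _ _ kl) tl.
  by rewrite mem_set.
have limg t : limn (g^~ t) = (@hardy_weight R n m w lams t)%:E.
  apply/cvg_lim => //.
  have [wt0|wt0] := eqVneq (w t) 0.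
    rewrite (_ : g^~ t = cst (@hardy_weight R n m w lams t)%:E); first exact: cvg_cst.
    by apply/funext => k; rewrite /g /truncated_weight /hardy_weight wt0 !(mulr0, mul0r).
  have tpos i : 0 < tnth t i by exact: w_supp_gt0 w_supp _ wt0 i.
  (* From this index on, every coordinate of t is at least 1/(k + 2), so the truncation no longer
     acts at t. *)
  pose M := \max_(i < m) Num.trunc (tnth t i)^-1.
  apply: cvg_near_cst; exists M => // k /= Mk.
  rewrite /g /truncated_weight indicE mem_set ?mulr1// => i.
  rewrite /= in_itv/= andbT -[leRHS]invrK lef_pV2 ?posrE ?invr_gt0//.
  have ti0 : 0 <= (tnth t i)^-1 by rewrite invr_ge0 ltW.
  have /andP[_ /ltW ti] := truncn_itv ti0.
  apply: (le_trans ti); rewrite ler_nat ltnS leqW// (leq_trans _ Mk)//.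
  exact: (leq_bigmax (F := fun i => Num.trunc (tnth t i)^-1)).
have := cvg_monotone_convergence (mu := mu m) measurableT mg g0 ndg.
rewrite (_ : (\int[mu m]_t limn (g^~ t))%E =
    (\int[mu m]_t (@hardy_weight R n m w lams t)%:E)%E); last first.
  by apply: eq_integral => t _; rewrite limg.
move=> cv; rewrite -(cvg_lim _ cv)//; apply: lime_le; first by apply/cvg_ex; eexists; exact: cv.
apply: nearW => k; apply: truncated_weight_integral_le => //.
by rewrite ltr1n.
Qed.

End lower_bound.

Theorem theorem2p2 (R : realType) (n m : nat) (omega : Rn R m -> R)
    (p lambda : R) (ps lambdas : 'I_m -> R)
    (n_gt0 : (0 < n)%N) (m_gt0 : (0 < m)%N)
    (omega_ge0 : forall t, closed_cube t -> 0 <= omega t)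
    (omega_integrable :
      (lebesgue_Rn R m).-integrable closed_cube (fun t => (omega t)%:E))
    (p_gt1 : 1 < p) (ps_gtp : forall i, p < ps i)
    (lambdas_range : forall i, - (ps i)^-1 <= lambdas i < 0)
    (p_def : p^-1 = \sum_(i < m) (ps i)^-1)
    (lambda_def : lambda = \sum_(i < m) lambdas i) :
  ((hardy_constant n omega lambdas < +oo)%E ->
    hardy_bounded n omega ps lambdas p lambda /\
    (hardy_opnorm n omega ps lambdas p lambda <=
     hardy_constant n omega lambdas)%E) /\
  ((forall i j, lambdas i * ps i = lambdas j * ps j) ->
    (hardy_bounded n omega ps lambdas p lambda ->
     (hardy_constant n omega lambdas < +oo)%E) /\
    hardy_opnorm n omega ps lambdas p lambda =
    hardy_constant n omega lambdas).
Proof.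
have p_gt0 : 0 < p by exact: lt_trans p_gt1.
have ps_gt0 i : 0 < ps i by exact: lt_trans (ps_gtp i).
rewrite lambda_def.
set A := hardy_constant n omega lambdas.
have A_ge0 : (0 <= A)%E by exact: hardy_constant_ge0.
have upper : (A < +oo)%E ->
    hardy_bounded n omega ps lambdas p (\sum_(i < m) lambdas i) /\
    (hardy_opnorm n omega ps lambdas p (\sum_(i < m) lambdas i) <= A)%E.
  move=> A_lty.
  have HA := hardy_bound_constant omega_ge0 omega_integrable p_gt1 ps_gt0 p_def A_lty.
  split; first by exists (fine A).
  apply: ereal_inf_lbound; exists (fine A) => //.
  by rewrite fineK// ge0_fin_numE.
split=> // lamps_eq.
pose i0 := Ordinal m_gt0.
pose th := - (lambdas i0 * ps i0).
have lamE i : lambdas i * ps i = - th by rewrite /th opprK.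
(* This is the range -1/p_i <= lambda_i < 0 multiplied by -p_i. *)
have th01 : 0 < th <= 1.
  have /andP[lam_lb lam_lt0] := lambdas_range i0.
  rewrite /th -mulNr mulr_gt0 ?oppr_gt0//= -(mulVf (lt0r_neq0 (ps_gt0 i0))).
  by rewrite ler_pM2r// lerNl.
have [Nw [w [mNw Nw0 mw [w0 wsupp] wE]]] := weight_modification omega_ge0 omega_integrable.
have lower C : hardy_bound n omega ps lambdas p (\sum_(i < m) lambdas i) C -> (A <= C%:E)%E.
  exact: (hardy_constant_le omega_integrable n_gt0 p_gt0 ps_gt0 p_def th01 lamE
    mNw Nw0 mw w0 wsupp wE).
split=> [[C /lower A_le]|]; first by apply: le_lt_trans A_le _; rewrite ltey.
(* The norm is an infimum over all bounds: [upper] makes A one of them when A is finite, and [lower]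
   puts A below each of them. *)
apply/eqP; rewrite eq_le; apply/andP; split.
  have [->|A_neqy] := eqVneq A +oo%E; first by rewrite leey.
  by have [] := upper _; rewrite ?ltey.
by apply: le_ereal_inf_tmp => _ [C /lower A_le <-].
Qed.
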